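(* Let $k\in\{1,2\}$ and let $\Delta_k(n)$ be defined by \[\sum_{n=0}^{\infty}\Delta_k(n)q^n=\prod_{n=1}^{\infty}\frac{(1-q^{2n})(1-q^{(2k+1)n})}{(1-q^n)^3(1-q^{(4k+2)n})}.\] Then for all $n\ge1$, \[\Delta_k^2(n)\ge\Delta_k(n-1)\Delta_k(n+1).\]
   Context: $\Delta_k(n)$ is the number of broken $k$-diamond partitions of $n$ (in the sense of Andrews and Paule), whose generating function is the product displayed. *)

(* Defs.v *)
From mathcomp Require Import all_boot all_order all_algebra.

Set Implicit Arguments.
Unset Strict Implicit.
Unset Printing Implicit Defensive.

Import GRing.Theory Num.Theory.
Local Open Scope ring_scope.

(* A formal power series in q over int, given by its coefficient sequence. *)
Definition fps := nat -> int.

Definition fps_one : fps := fun n => (n == 0%N)%:R.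

Definition fps_mul (f g : fps) : fps :=
  fun n => \sum_(i < n.+1) f i * g (n - i)%N.

Definition fps_exp (f : fps) (e : nat) : fps := iter e (fps_mul f) fps_one.

(* Coefficients 0, ..., n-1 of the multiplicative inverse of f, by the usual
   recursion; meaningful only when f has constant term 1 (see fps_mulV). *)
Fixpoint fps_inv_seq (f : fps) (n : nat) : seq int :=
  if n is m.+1 then
    let s := fps_inv_seq f m in
    rcons s ((m == 0%N)%:R - \sum_(i < m) f i.+1 * s`_(m - i.+1))
  else [::].

Definition fps_inv (f : fps) : fps := fun n => (fps_inv_seq f n.+1)`_n.

Definition fps_div (f g : fps) : fps := fps_mul f (fps_inv g).

(* The series 1 - q^m, for m > 0. *)
Definition one_sub_q (m : nat) : fps :=
  fun n => (n == 0%N)%:R - (n == m)%:R.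

Definition fps_partial_prod (F : nat -> fps) (N : nat) : fps :=
  \big[fps_mul/fps_one]_(1 <= m < N.+1) F m.

(* f is the infinite product of F 1, F 2, ...: every coefficient of the partial
   products is eventually constant, equal to that of f (q-adic convergence). *)
Definition is_fps_prod (F : nat -> fps) (f : fps) : Prop :=
  forall n, exists N0 : nat, forall N : nat, (N0 <= N)%N ->
    fps_partial_prod F N n = f n.

Definition diamond_factor (k m : nat) : fps :=
  fps_div
    (fps_mul (one_sub_q (2 * m)) (one_sub_q ((2 * k + 1) * m)))
    (fps_mul (fps_exp (one_sub_q m) 3) (one_sub_q ((4 * k + 2) * m))).

(* The lemmas below show that fps_inv is the inverse on series with constant
   term 1, and that the infinite product of the diamond_factor k m exists and
   is unique. *)

Lemma size_fps_inv_seq f n : size (fps_inv_seq f n) = n.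
Proof. by elim: n => //= n IH; rewrite size_rcons IH. Qed.

Lemma nth_fps_inv_seq f n i : (i < n)%N -> (fps_inv_seq f n)`_i = fps_inv f i.
Proof.
elim: n => // n IH; rewrite ltnS leq_eqVlt => /orP[/eqP-> //|ltin].
by rewrite /= nth_rcons size_fps_inv_seq ltin IH.
Qed.

Lemma fps_invE f n :
  fps_inv f n = (n == 0%N)%:R - \sum_(i < n) f i.+1 * fps_inv f (n - i.+1)%N.
Proof.
rewrite {1}/fps_inv /= nth_rcons size_fps_inv_seq ltnn eqxx; congr (_ - _).
apply: eq_bigr => -[i ltin] _ /=; rewrite nth_fps_inv_seq //.
by rewrite ltn_subrL (leq_ltn_trans _ ltin).
Qed.

Lemma fps_mulV f : f 0%N = 1 -> fps_mul f (fps_inv f) =1 fps_one.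
Proof.
move=> f0 n; rewrite /fps_mul big_ord_recl /= f0 mul1r subn0 fps_invE.
by rewrite /bump /= subrK.
Qed.

Definition fps_eq1_upto (n : nat) (f : fps) : Prop :=
  f 0%N = 1 /\ forall i, (0 < i <= n)%N -> f i = 0.

Lemma fps_mul_eq1_upto n f g :
  fps_eq1_upto n g -> forall i, (i <= n)%N -> fps_mul f g i = f i.
Proof.
move=> [g0 gi] i lein; rewrite /fps_mul big_ord_recr /= subnn g0 mulr1.
rewrite big1 ?add0r // => -[j ltji] _ /=; rewrite gi ?mulr0 //.
by rewrite subn_gt0 ltji (leq_trans (leq_subr _ _) lein).
Qed.

Lemma fps_mul_eq1_uptoM n f g :
  fps_eq1_upto n f -> fps_eq1_upto n g -> fps_eq1_upto n (fps_mul f g).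
Proof.
move=> [f0 fi] g1; split; first by rewrite (fps_mul_eq1_upto _ g1).
by move=> i /andP[i0 lein]; rewrite (fps_mul_eq1_upto _ g1) // fi ?i0.
Qed.

Lemma fps_inv_eq1_upto n f : fps_eq1_upto n f -> fps_eq1_upto n (fps_inv f).
Proof.
move=> [f0 fi]; split=> [|i /andP[i0 lein]].
  by rewrite fps_invE big_ord0 subr0.
rewrite fps_invE gtn_eqF // big1 ?subr0 // => -[j ltji] _ /=.
by rewrite fi ?mul0r //= (leq_trans ltji lein).
Qed.

Lemma one_sub_q_eq1_upto n m : (n < m)%N -> fps_eq1_upto n (one_sub_q m).
Proof.
case: m => // m ltnm; rewrite /one_sub_q; split=> [|i /andP[i0 lein]].
  by rewrite eqxx subr0.
by rewrite (gtn_eqF i0) (ltn_eqF (leq_ltn_trans lein ltnm)) subr0.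
Qed.

Lemma fps_one_eq1_upto n : fps_eq1_upto n fps_one.
Proof. by split=> // i /andP[i0 _]; rewrite /fps_one gtn_eqF. Qed.

Lemma diamond_den_eq1_upto k m n : (n < m)%N ->
  fps_eq1_upto n
    (fps_mul (fps_exp (one_sub_q m) 3) (one_sub_q ((4 * k + 2) * m))).
Proof.
move=> ltnm; have h1 := one_sub_q_eq1_upto ltnm.
apply: fps_mul_eq1_uptoM.
  by do 3! [apply: (fps_mul_eq1_uptoM h1)]; apply: fps_one_eq1_upto.
by apply/one_sub_q_eq1_upto/(leq_trans ltnm); rewrite leq_pmull // addn2.
Qed.

Lemma diamond_factor_eq1_upto k m n :
  (n < m)%N -> fps_eq1_upto n (diamond_factor k m).
Proof.
move=> ltnm; apply: fps_mul_eq1_uptoM.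
  by apply: fps_mul_eq1_uptoM; apply/one_sub_q_eq1_upto/(leq_trans ltnm);
     rewrite leq_pmull // addn1.
exact/fps_inv_eq1_upto/diamond_den_eq1_upto.
Qed.

Lemma fps_mul_eq_upto n f g h : (forall i, (i <= n)%N -> g i = h i) ->
  forall i, (i <= n)%N -> fps_mul f g i = fps_mul f h i.
Proof.
move=> gh i lein; apply: eq_bigr => j _; rewrite gh //.
exact: leq_trans (leq_subr _ _) lein.
Qed.

Lemma diamond_partial_prod_stable k n N : (n <= N)%N ->
  fps_partial_prod (diamond_factor k) N n =
  fps_partial_prod (diamond_factor k) n n.
Proof.
move=> lenN; rewrite /fps_partial_prod /index_iota !subSS !subn0.
rewrite -{1}(subnKC lenN) iotaD.
set t := iota (1 + n) _; set s := iota 1 n.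
have t1 : fps_eq1_upto n (\big[fps_mul/fps_one]_(m <- t) diamond_factor k m).
  rewrite big_seq; apply: (big_ind (fps_eq1_upto n)).
  - exact: fps_one_eq1_upto.
  - by move=> f g; apply: fps_mul_eq1_uptoM.
  - by move=> m; rewrite mem_iota => /andP[lt_nm _]; apply: diamond_factor_eq1_upto.
suff: forall i, (i <= n)%N ->
    (\big[fps_mul/fps_one]_(m <- s ++ t) diamond_factor k m) i =
    (\big[fps_mul/fps_one]_(m <- s) diamond_factor k m) i by apply.
elim: s => [|m s IH] /= i lein; last first.
  by rewrite !big_cons; apply: (fps_mul_eq_upto _ IH).
rewrite big_nil; case: i lein => [|i] lein; first by rewrite t1.1.
by rewrite t1.2.
Qed.

Lemma diamond_prod_exists k : exists D : fps, is_fps_prod (diamond_factor k) D.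
Proof.
exists (fun n => fps_partial_prod (diamond_factor k) n n) => n.
by exists n => N; apply: diamond_partial_prod_stable.
Qed.

Lemma fps_prod_unique F f g : is_fps_prod F f -> is_fps_prod F g -> f =1 g.
Proof.
move=> Ff Fg n; have [N1 H1] := Ff n; have [N2 H2] := Fg n.
by rewrite -(H1 (maxn N1 N2)) ?leq_maxl // (H2 _ (leq_maxr _ _)).
Qed.

(* Main.v *)
(** Write the generating function as a product of factors [1 / (1 - q^j)], each
    [j] occurring two or three times.  By AM-GM, [a (n-1) * a (n+1) <= a n ^ 2]
    follows if [exp (- n s) * a n] is concave at [n] for some [s > 0], that is, if
    the integral over [-PI, PI] of [|F| cos (arg F - n th) (1 - cos th)] is
    nonnegative, where [F] is the product at [q = exp (- s + i th)].  Take for [s]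
    the saddle point, where [arg F - n th = O (th ^ 3)].  The cosine is then
    positive for [th] up to the order [s ^ (3/2)], where [|F|] is nearly Gaussian,
    and elsewhere [|F|] is so small that no modular transformation is needed.
    All error terms are controlled for [n >= 1600], using only that the
    multiplicities are 2 or 3.  The remaining [n] are checked by computing the
    series with the sparse expansion of Euler's products (pentagonal numbers). *)

From Stdlib Require Import Reals Ranalysis5 Lra Lia Psatz ZArith List Bool.
From Coquelicot Require Import Coquelicot.

Section Analysis.

Local Open Scope R_scope.

(** * Fourier coefficients of the product *)

(** Only the sign of one integral is needed, so no asymptotic formula for the coefficients is
    derived. The difficulty is numerical: [|F|] is bounded below with multiplicity 3 and above with
    multiplicity 2, so a peak estimated too low has to outweigh a tail estimated too high. With
    [w = sqrt s] both are of order [w^9], and the balance is 1329 against 1161. Infinite products do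
    not occur on the analytic side: for each [n], all parts above some [N >= 1000 n^2] are dropped.
    This changes no coefficient up to [N], and since the saddle point satisfies [s >= 1 / n], the
    truncation error in the upper bounds for [ln |F|] stays below 1/100. The threshold comes from
    the saddle point equation [mean L s = n], where [mean L s <= 3 zeta(2) / s^2]. With 400/243 in
    place of [zeta(2)] the right side is exactly 1600 at [s = 1/18]. Hence every [n >= 1600] has a
    saddle point with [s <= 1/18], the range for which all numerical constants are fitted. *)

Lemma ex_RInt_minusR (f g : R -> R) (a b : R) :
  ex_RInt f a b -> ex_RInt g a b -> ex_RInt (fun x => f x - g x) a b.
Proof. exact (ex_RInt_minus f g a b). Qed.

Lemma ex_RInt_scalR (c : R) (f : R -> R) (a b : R) :
  ex_RInt f a b -> ex_RInt (fun x => c * f x) a b.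
Proof. exact (ex_RInt_scal f a b c). Qed.

Lemma RInt_minusR (f g : R -> R) (a b : R) : ex_RInt f a b -> ex_RInt g a b ->
  RInt (fun x => f x - g x) a b = RInt f a b - RInt g a b.
Proof. exact (RInt_minus f g a b). Qed.

Lemma RInt_scalR (c : R) (f : R -> R) (a b : R) : ex_RInt f a b ->
  RInt (fun x => c * f x) a b = c * RInt f a b.
Proof. exact (RInt_scal f a b c). Qed.

Lemma RInt_extR (f g : R -> R) (a b : R) : (forall x, f x = g x) -> RInt f a b = RInt g a b.
Proof. intros H. apply (RInt_ext f g). intros x _. apply H. Qed.

Definition sumL (L : list nat) (h : nat -> R) : R :=
  fold_right (fun j a => h j + a) 0 L.

Definition geomZ (j : nat) (f : nat -> Z) (n : nat) : Z :=
  fold_right (fun i a => (f (n - i * j)%nat + a)%Z) 0%Z (seq 0 (S (n / j))).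

(** The number of partitions of [n] into parts from [L], where repeated entries of [L] count as
    parts of different colours; [geomZ j] is multiplication by [1 / (1 - q^j)]. *)
Fixpoint partgf (L : list nat) : nat -> Z :=
  match L with
  | nil => fun n => if Nat.eqb n 0 then 1%Z else 0%Z
  | j :: L' => geomZ j (partgf L')
  end.

Lemma geomZ_rec (j : nat) (f : nat -> Z) (n : nat) : (1 <= j)%nat ->
  geomZ j f n = (f n + if Nat.leb j n then geomZ j f (n - j) else 0)%Z.
Proof.
intros hj. unfold geomZ.
change (seq 0 (S (n / j))) with (0%nat :: seq 1 (n / j)). cbn [fold_right].
rewrite Nat.mul_0_l, Nat.sub_0_r. f_equal.
destruct (Nat.leb_spec j n) as [h|h].
- replace (n / j)%nat with (S ((n - j) / j)).
  + rewrite <- seq_shift. generalize (seq 0 (S ((n - j) / j))).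
    induction l as [|i l IH]; [reflexivity|]. cbn [map fold_right].
    rewrite IH. f_equal. f_equal. lia.
  + replace n with ((n - j) + 1 * j)%nat at 2 by lia.
    rewrite Nat.div_add by lia. lia.
- rewrite Nat.div_small by lia. reflexivity.
Qed.

Lemma partgf_nonneg (L : list nat) (n : nat) : (0 <= partgf L n)%Z.
Proof.
revert n; induction L as [|j L IH]; intros n; cbn [partgf].
- destruct (Nat.eqb n 0); lia.
- unfold geomZ. generalize (seq 0 (S (n / j))). induction l as [|i l IHl]; simpl; [lia|].
  specialize (IH (n - i * j)%nat). lia.
Qed.

(* With [z = r * exp (i y)]: [modsq] is [|1 - z|^2], [lnmod] is [ln |1 - z|] and
   [arg1] is the argument of [1 / (1 - z)].  At [q = exp (- s + i th)] the product [F]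
   over [L] is [exp (lnG + i phase)], and [wave] is the real part of [F exp (- i n th)]. *)
Definition modsq (r y : R) : R := 1 - 2 * r * cos y + r ^ 2.
Definition lnmod (r y : R) : R := / 2 * ln (modsq r y).
Definition arg1 (r y : R) : R := atan (r * sin y / (1 - r * cos y)).
Definition rho (s : R) (j : nat) : R := exp (- (INR j * s)).
Definition lnG (L : list nat) (s th : R) : R :=
  - sumL L (fun j => lnmod (rho s j) (INR j * th)).
Definition phase (L : list nat) (s th : R) : R :=
  sumL L (fun j => arg1 (rho s j) (INR j * th)).
Definition wave (L : list nat) (s : R) (n : Z) (th : R) : R :=
  exp (lnG L s th) * cos (phase L s th - IZR n * th).
Definition fourier (L : list nat) (s : R) (n : Z) : R := RInt (wave L s n) (- PI) PI.

Lemma rcos_lt1 (r y : R) : 0 < r < 1 -> 0 < 1 - r * cos y.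
Proof. intros h. generalize (COS_bound y). nra. Qed.

Lemma modsq_ge (r y : R) : 0 < r < 1 -> (1 - r) ^ 2 <= modsq r y.
Proof. intros h. unfold modsq. generalize (COS_bound y). nra. Qed.

Lemma modsq_pos (r y : R) : 0 < r < 1 -> 0 < modsq r y.
Proof. intros h. generalize (modsq_ge r y h). nra. Qed.

Lemma modsq_polar (r y : R) : modsq r y = (1 - r * cos y) ^ 2 + (r * sin y) ^ 2.
Proof. unfold modsq. generalize (sin2_cos2 y). unfold Rsqr. intros h. nra. Qed.

Lemma is_derive_lnmod (r y : R) : 0 < r < 1 ->
  is_derive (lnmod r) y (r * sin y / modsq r y).
Proof.
intros h. generalize (modsq_pos r y h). unfold lnmod, modsq. intros hp.
auto_derive; [lra|]. field. lra.
Qed.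

Lemma is_derive_arg1 (r y : R) : 0 < r < 1 ->
  is_derive (arg1 r) y ((r * cos y - r ^ 2) / modsq r y).
Proof.
intros h. generalize (modsq_pos r y h) (rcos_lt1 r y h). rewrite modsq_polar. intros hp hq.
unfold arg1. auto_derive; [lra|].
generalize (sin2_cos2 y). unfold Rsqr. intros hs.
assert (E : r * cos y - r ^ 2 = r * cos y * (1 - r * cos y) - r * sin y * (r * sin y)).
{ replace (r ^ 2) with (r * r * (sin y * sin y + cos y * cos y)) by (rewrite hs; ring). ring. }
rewrite E. field. split; [|lra]. nra.
Qed.

(** Both sides are the real part of [exp (i x) (1 - z)] for [z = r exp (i y)], once in polar and
    once in cartesian form. The arctangent gives the right argument because [1 - z] has positive
    real part. *)
Lemma cos_arg1 (r y x : R) : 0 < r < 1 ->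
  exp (lnmod r y) * cos (x - arg1 r y) = cos x - r * cos (x + y).
Proof.
intros h.
assert (hp := modsq_pos r y h). assert (hq := rcos_lt1 r y h).
set (a := 1 - r * cos y) in *. set (b := r * sin y).
assert (hm : modsq r y = a ^ 2 + b ^ 2) by (unfold a, b; apply modsq_polar).
assert (E : exp (lnmod r y) = sqrt (a ^ 2 + b ^ 2)).
{ unfold lnmod. rewrite hm in *. rewrite <- Rpower_sqrt by lra. reflexivity. }
assert (S : sqrt (1 + (b / a)²) = sqrt (a ^ 2 + b ^ 2) / a).
{ rewrite <- (sqrt_pow2 a) at 3 by lra. rewrite <- sqrt_div_alt by nra.
  f_equal. unfold Rsqr. field. lra. }
assert (P : 0 < sqrt (a ^ 2 + b ^ 2)) by (apply sqrt_lt_R0; lra).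
unfold arg1. fold a b. rewrite cos_minus, cos_atan, sin_atan, S, E.
replace (sqrt (a ^ 2 + b ^ 2) * (cos x * (1 / (sqrt (a ^ 2 + b ^ 2) / a)) +
  sin x * (b / a / (sqrt (a ^ 2 + b ^ 2) / a)))) with (a * cos x + b * sin x)
  by (field; lra).
unfold a, b. rewrite cos_plus. ring.
Qed.

Lemma rho_bounds (s : R) (j : nat) : 0 < s -> (1 <= j)%nat -> 0 < rho s j < 1.
Proof.
intros hs hj. unfold rho. split; [apply exp_pos|].
rewrite <- exp_0. apply exp_increasing.
assert (1 <= INR j) by (apply (le_INR 1); lia). nra.
Qed.

Ltac splits := repeat (match goal with |- _ /\ _ => split | |- True => exact I end).

Definition all_pos (L : list nat) : Prop := List.Forall (fun j => (1 <= j)%nat) L.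

Lemma ex_derive_sumL (L : list nat) (f : nat -> R -> R) (x : R) :
  List.Forall (fun j => ex_derive (f j) x) L ->
  ex_derive (fun y => sumL L (fun j => f j y)) x.
Proof.
induction 1; simpl.
- apply ex_derive_const.
- apply (ex_derive_plus (f _)); assumption.
Qed.

Lemma ex_derive_lnG (L : list nat) (s x : R) : 0 < s -> all_pos L -> ex_derive (lnG L s) x.
Proof.
intros hs hL. unfold lnG.
apply (ex_derive_opp (fun th => sumL L (fun j => lnmod (rho s j) (INR j * th)))).
apply (ex_derive_sumL L (fun j th => lnmod (rho s j) (INR j * th))).
eapply List.Forall_impl; [|exact hL]. intros j hj. cbn beta.
apply (ex_derive_comp (lnmod (rho s j)) (fun th => INR j * th)).
- eexists. apply is_derive_lnmod, rho_bounds; assumption.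
- auto_derive; auto.
Qed.

Lemma ex_derive_phase (L : list nat) (s x : R) : 0 < s -> all_pos L -> ex_derive (phase L s) x.
Proof.
intros hs hL. unfold phase.
apply (ex_derive_sumL L (fun j th => arg1 (rho s j) (INR j * th))).
eapply List.Forall_impl; [|exact hL]. intros j hj. cbn beta.
apply (ex_derive_comp (arg1 (rho s j)) (fun th => INR j * th)).
- eexists. apply is_derive_arg1, rho_bounds; assumption.
- auto_derive; auto.
Qed.

Ltac ex_derive_tac :=
  match goal with
  | |- ex_derive (fun x => lnG _ _ x) _ => apply ex_derive_lnG; assumption
  | |- ex_derive (fun x => phase _ _ x) _ => apply ex_derive_phase; assumption
  end.

Lemma ex_derive_wave (L : list nat) (s : R) (n : Z) (x : R) :
  0 < s -> all_pos L -> ex_derive (wave L s n) x.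
Proof.
intros hs hL. unfold wave. auto_derive.
splits; ex_derive_tac.
Qed.

Lemma ex_RInt_ex_derive (f : R -> R) (a b : R) : (forall x, ex_derive f x) -> ex_RInt f a b.
Proof.
intros h. apply (ex_RInt_continuous f). intros z _. apply (ex_derive_continuous f z), h.
Qed.

Lemma ex_RInt_wave (L : list nat) (s : R) (n : Z) (a b : R) :
  0 < s -> all_pos L -> ex_RInt (wave L s n) a b.
Proof. intros hs hL. apply ex_RInt_ex_derive. intros x. apply ex_derive_wave; assumption. Qed.

(* Multiplying by [1 - (r e^{i th})^j] removes one factor of the product. *)
Lemma wave_cons (j : nat) (L : list nat) (s : R) (n : Z) (th : R) :
  0 < s -> (1 <= j)%nat ->
  wave L s n th = wave (j :: L) s n th - rho s j * wave (j :: L) s (n - Z.of_nat j) th.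
Proof.
intros hs hj. unfold wave, lnG, phase. cbn [sumL fold_right].
fold (sumL L (fun j => lnmod (rho s j) (INR j * th))).
fold (sumL L (fun j => arg1 (rho s j) (INR j * th))).
set (a := sumL L _). set (b := sumL L _).
rewrite minus_IZR, <- INR_IZR_INZ.
set (p := arg1 _ _ + b - IZR n * th).
replace (b - IZR n * th) with (p - arg1 (rho s j) (INR j * th)) by (unfold p; ring).
replace (arg1 (rho s j) (INR j * th) + b - (IZR n - INR j) * th) with (p + INR j * th)
  by (unfold p; ring).
replace (- a) with (- (lnmod (rho s j) (INR j * th) + a) + lnmod (rho s j) (INR j * th)) by ring.
rewrite exp_plus, Rmult_assoc, cos_arg1 by (apply rho_bounds; assumption). ring.
Qed.

Lemma fourier_cons (j : nat) (L : list nat) (s : R) (n : Z) :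
  0 < s -> all_pos (j :: L) ->
  fourier L s n = fourier (j :: L) s n - rho s j * fourier (j :: L) s (n - Z.of_nat j).
Proof.
intros hs hL. inversion_clear hL as [|? ? hj hL']. unfold fourier.
assert (hL : all_pos (j :: L)) by (constructor; assumption).
assert (W : forall m, ex_RInt (wave (j :: L) s m) (- PI) PI)
  by (intros; apply ex_RInt_wave; assumption).
rewrite <- RInt_scalR by apply W.
rewrite <- RInt_minusR; [|apply W|apply ex_RInt_scalR, W].
apply RInt_extR. intros th. apply wave_cons; assumption.
Qed.

(** The bound is uniform in [n], which is what the iteration in [fourier_neg] needs. *)
Lemma fourier_bounded (L : list nat) (s : R) : 0 < s -> all_pos L ->
  exists B, forall n, Rabs (fourier L s n) <= B.
Proof.
intros hs hL. exists (RInt (fun th => exp (lnG L s th)) (- PI) PI). intros n.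
assert (hpi := PI_RGT_0).
assert (E : ex_RInt (fun th => exp (lnG L s th)) (- PI) PI).
{ apply ex_RInt_ex_derive. intros x. auto_derive. splits; ex_derive_tac. }
apply Rabs_le. split.
- replace (- RInt (fun th => exp (lnG L s th)) (- PI) PI) with
    (-1 * RInt (fun th => exp (lnG L s th)) (- PI) PI) by ring.
  rewrite <- RInt_scalR by exact E.
  apply RInt_le; [lra| apply ex_RInt_scalR, E| apply ex_RInt_wave; assumption|].
  intros x _. unfold wave. generalize (exp_pos (lnG L s x)) (COS_bound (phase L s x - IZR n * x)).
  nra.
- apply RInt_le; [lra| apply ex_RInt_wave; assumption| exact E|].
  intros x _. unfold wave. generalize (exp_pos (lnG L s x)) (COS_bound (phase L s x - IZR n * x)).
  nra.
Qed.

Lemma fourier_nil (s : R) (n : Z) :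
  fourier nil s n = if Z.eqb n 0 then 2 * PI else 0.
Proof.
unfold fourier, wave, lnG, phase. simpl.
destruct (Z.eqb_spec n 0) as [->|hn].
- rewrite (RInt_ext _ (fun _ => 1)).
  + rewrite RInt_const. unfold scal; simpl; unfold mult; simpl. ring.
  + intros x _. replace (0 - 0 * x) with 0 by ring. rewrite cos_0, Ropp_0, exp_0. apply Rmult_1_l.
- assert (hz : IZR n <> 0) by (apply not_0_IZR; assumption).
  rewrite (RInt_ext _ (fun x => cos (IZR n * x))).
  + set (F := fun x => sin (IZR n * x) / IZR n).
    assert (H : is_RInt (fun x => cos (IZR n * x)) (- PI) PI (minus (F PI) (F (- PI)))).
    { apply (is_RInt_derive F (fun x => cos (IZR n * x))).
      - intros x _. unfold F. auto_derive; [exact I|]. field. exact hz.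
      - intros x _. apply (ex_derive_continuous (fun x => cos (IZR n * x))). auto_derive. auto. }
    rewrite (is_RInt_unique _ _ _ _ H). unfold F, minus, plus, opp; simpl.
    replace (IZR n * - PI) with (- (IZR n * PI)) by ring.
    rewrite sin_neg, (sin_eq_0_1 (IZR n * PI)) by (exists n; reflexivity).
    field. exact hz.
  + intros x _. replace (0 - IZR n * x) with (- (IZR n * x)) by ring.
    rewrite cos_neg, Ropp_0, exp_0. apply Rmult_1_l.
Qed.

(** For negative [n] the term without [j] in [fourier_cons] vanishes by induction, so the
    coefficient at [n] is [rho ^ k] times the one at [n - k j] for every [k]. Boundedness and
    [rho < 1] then force it to be 0. *)
Lemma fourier_neg (L : list nat) (s : R) (n : Z) :
  0 < s -> all_pos L -> (n < 0)%Z -> fourier L s n = 0.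
Proof.
intros hs. revert n. induction L as [|j L IH]; intros n hL hn.
- rewrite fourier_nil. destruct (Z.eqb_spec n 0); [lia|reflexivity].
- inversion_clear hL as [|? ? hj hL'] .
  assert (hL : all_pos (j :: L)) by (constructor; assumption).
  destruct (fourier_bounded (j :: L) s hs hL) as [B hB].
  assert (hr := rho_bounds s j hs hj).
  assert (I : forall k : nat, fourier (j :: L) s n =
      rho s j ^ k * fourier (j :: L) s (n - Z.of_nat k * Z.of_nat j)).
  { induction k as [|k IHk].
    - simpl. rewrite Z.sub_0_r. ring.
    - rewrite IHk.
      assert (E := fourier_cons j L s (n - Z.of_nat k * Z.of_nat j) hs hL).
      rewrite IH in E by (assumption || lia).
      replace (n - Z.of_nat (S k) * Z.of_nat j)%Z
        with (n - Z.of_nat k * Z.of_nat j - Z.of_nat j)%Z by lia.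
      simpl. rewrite (Rmult_comm (rho s j)), Rmult_assoc. f_equal. lra. }
  assert (Z : is_lim_seq (fun k => rho s j ^ k * B) 0).
  { replace (Finite 0) with (Rbar_mult 0 B) by (simpl; f_equal; ring).
    apply is_lim_seq_scal_r. apply is_lim_seq_geom. rewrite Rabs_pos_eq; lra. }
  assert (H : Rabs (fourier (j :: L) s n) <= 0).
  { apply (is_lim_seq_le (fun _ => Rabs (fourier (j :: L) s n)) (fun k => rho s j ^ k * B)
      (Rabs (fourier (j :: L) s n)) 0); [|apply is_lim_seq_const|exact Z].
    intros k. rewrite (I k) at 1. rewrite Rabs_mult.
    assert (0 < rho s j ^ k) by (apply pow_lt; lra).
    rewrite (Rabs_pos_eq (rho s j ^ k)) by lra.
    apply Rmult_le_compat_l; [lra|apply hB]. }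
  revert H. unfold Rabs. destruct (Rcase_abs _); lra.
Qed.

(** Both sides obey the same recursion in [L] and [n], with the same initial values. Cauchy's
    formula is thus obtained without exchanging an integral and an infinite series. *)
Lemma fourier_partgf (L : list nat) (s : R) (n : nat) : 0 < s -> all_pos L ->
  fourier L s (Z.of_nat n) = 2 * PI * exp (- (INR n * s)) * IZR (partgf L n).
Proof.
intros hs. revert n. induction L as [|j L IH]; intros n hL.
- rewrite fourier_nil. cbn [partgf].
  destruct n as [|n]; [simpl; rewrite Rmult_0_l, Ropp_0, exp_0; ring|].
  replace (Z.of_nat (S n) =? 0)%Z with false by (symmetry; apply Z.eqb_neq; lia).
  simpl Nat.eqb. cbv iota. ring.
- inversion_clear hL as [|? ? hj hL'].
  assert (hL : all_pos (j :: L)) by (constructor; assumption).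
  induction n as [n IHn] using lt_wf_ind.
  assert (E := fourier_cons j L s (Z.of_nat n) hs hL). rewrite IH in E by assumption.
  cbn [partgf]. rewrite geomZ_rec by assumption.
  destruct (Nat.leb_spec j n) as [h|h].
  + rewrite <- Nat2Z.inj_sub in E by assumption. rewrite (IHn (n - j)%nat) in E by lia.
    cbn [partgf] in E. rewrite plus_IZR.
    assert (X : exp (- (INR n * s)) = rho s j * exp (- (INR (n - j) * s))).
    { unfold rho. rewrite <- exp_plus. f_equal. rewrite minus_INR by assumption. ring. }
    rewrite Rmult_plus_distr_l. rewrite X at 2. lra.
  + rewrite (fourier_neg _ _ (Z.of_nat n - Z.of_nat j)) in E by (assumption || lia).
    rewrite Z.add_0_r. lra.
Qed.

(** Since [2 cos p - cos (p + th) - cos (p - th) = 2 cos p (1 - cos th)], the integral is a negated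
    second difference of Fourier coefficients. It yields [exp s * a (n-1) + exp (-s) * a (n+1) <= 2
    a n], and the product of the two summands on the left no longer contains [s]. *)
Lemma log_concave_of_RInt (L : list nat) (s : R) (n : nat) : 0 < s -> all_pos L -> (1 <= n)%nat ->
  0 <= RInt (fun th => exp (lnG L s th) * cos (phase L s th - INR n * th) * (1 - cos th)) (- PI) PI ->
  (partgf L (n - 1) * partgf L (n + 1) <= partgf L n * partgf L n)%Z.
Proof.
intros hs hL hn hI.
assert (E : 0 <= 2 * fourier L s (Z.of_nat n) - fourier L s (Z.of_nat (n - 1))
              - fourier L s (Z.of_nat (n + 1))).
{ replace (2 * fourier L s (Z.of_nat n) - fourier L s (Z.of_nat (n - 1))
              - fourier L s (Z.of_nat (n + 1))) with
    (2 * RInt (fun th => exp (lnG L s th) * cos (phase L s th - INR n * th) * (1 - cos th)) (- PI) PI);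
  [lra|].
  unfold fourier.
  assert (W : forall m, ex_RInt (wave L s m) (- PI) PI) by (intros; apply ex_RInt_wave; assumption).
  rewrite <- RInt_scalR, <- (RInt_scalR 2 (wave L s (Z.of_nat n))); [|apply W|].
  rewrite <- RInt_minusR; [|apply ex_RInt_scalR, W|apply W].
  rewrite <- RInt_minusR; [|apply ex_RInt_minusR; [apply ex_RInt_scalR|]; apply W|apply W].
  - apply RInt_extR. intros th.
    unfold wave. rewrite <- !INR_IZR_INZ, minus_INR, plus_INR by assumption.
    set (p := phase L s th - INR n * th).
    replace (phase L s th - (INR n - INR 1) * th) with (p + th) by (unfold p; simpl; ring).
    replace (phase L s th - (INR n + INR 1) * th) with (p - th) by (unfold p; simpl; ring).
    rewrite cos_plus, cos_minus. ring.
  - apply ex_RInt_ex_derive. intros x. auto_derive. splits; ex_derive_tac. }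
rewrite !fourier_partgf in E by assumption.
apply le_IZR. rewrite !mult_IZR.
assert (P0 := IZR_le _ _ (partgf_nonneg L (n - 1))).
assert (P1 := IZR_le _ _ (partgf_nonneg L (n + 1))).
assert (P2 := IZR_le _ _ (partgf_nonneg L n)).
set (a := IZR (partgf L (n - 1))) in *. set (b := IZR (partgf L n)) in *.
set (c := IZR (partgf L (n + 1))) in *.
assert (X1 : exp (- (INR (n - 1) * s)) = exp (- (INR n * s)) * exp s).
{ rewrite <- exp_plus. f_equal. rewrite minus_INR by assumption. simpl. ring. }
assert (X2 : exp (- (INR (n + 1) * s)) = exp (- (INR n * s)) * exp (- s)).
{ rewrite <- exp_plus. f_equal. rewrite plus_INR. simpl. ring. }
rewrite X1, X2 in E.
assert (M : exp s * exp (- s) = 1) by (rewrite <- exp_plus, Rplus_opp_r; apply exp_0).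
assert (Q1 := exp_pos s). assert (Q2 := exp_pos (- s)).
assert (Q3 : 0 < PI * exp (- (INR n * s))) by (apply Rmult_lt_0_compat; [apply PI_RGT_0|apply exp_pos]).
assert (F : exp s * a + exp (- s) * c <= 2 * b).
{ apply Rmult_le_reg_l with (2 * (PI * exp (- (INR n * s)))); [lra|]. lra. }
assert (G : (exp s * a) * (exp (- s) * c) = a * c) by (rewrite <- (Rmult_1_l (a * c)), <- M; ring).
rewrite <- G.
assert (0 <= exp s * a) by nra. assert (0 <= exp (- s) * c) by nra.
set (u := exp s * a) in *. set (v := exp (- s) * c) in *. clearbody u v.
assert ((u + v) * (u + v) <= (2 * b) * (2 * b)) by (apply Rmult_le_compat; lra).
assert (D := Rle_0_sqr (u - v)). unfold Rsqr in D. lra.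
Qed.

(** * Estimates for a single factor *)

(** The elementary inequalities below are differentiated down to an obvious one and integrated back
    from 0. *)
Lemma nonneg_of_derive (f df : R -> R) :
  (forall x, 0 <= x -> is_derive f x (df x)) -> (forall x, 0 <= x -> 0 <= df x) ->
  0 <= f 0 -> forall x, 0 <= x -> 0 <= f x.
Proof.
intros hf hdf h0 x hx.
destruct (MVT_gen f 0 x df) as [c [hc E]].
- intros z hz. rewrite Rmin_left in hz by lra. apply hf. lra.
- intros z hz. rewrite Rmin_left in hz by lra.
  apply continuity_pt_filterlim, @ex_derive_continuous. exists (df z). apply hf. lra.
- rewrite Rmin_left, Rmax_right in hc by lra.
  assert (0 <= df c) by (apply hdf; lra). nra.
Qed.

Lemma nonneg_of_derive_upto (b : R) (f df : R -> R) :
  (forall x, 0 <= x <= b -> is_derive f x (df x)) -> (forall x, 0 <= x <= b -> 0 <= df x) ->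
  0 <= f 0 -> forall x, 0 <= x <= b -> 0 <= f x.
Proof.
intros hf hdf h0 x hx.
destruct (MVT_gen f 0 x df) as [c [hc E]].
- intros z hz. rewrite Rmin_left, Rmax_right in hz by lra. apply hf. lra.
- intros z hz. rewrite Rmin_left, Rmax_right in hz by lra.
  apply continuity_pt_filterlim, @ex_derive_continuous. exists (df z). apply hf. lra.
- rewrite Rmin_left, Rmax_right in hc by lra.
  assert (0 <= df c) by (apply hdf; lra). nra.
Qed.

Lemma exp_neg_inv (t : R) : exp t * exp (- t) = 1.
Proof. rewrite <- exp_plus, Rplus_opp_r. apply exp_0. Qed.

Ltac derive_tac := intros; auto_derive; splits; try lra; try field; try lra.

Lemma sin_le_id (y : R) : 0 <= y -> sin y <= y.
Proof.
intros hy. destruct (Req_dec y 0) as [->|h]; [rewrite sin_0; lra|].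
apply Rlt_le, sin_lt_x. lra.
Qed.

Lemma one_sub_cos_le (y : R) : 1 - cos y <= y ^ 2 / 2.
Proof.
assert (H : forall y, 0 <= y -> 1 - cos y <= y ^ 2 / 2).
{ clear y. intros y hy. cut (0 <= y ^ 2 / 2 - 1 + cos y); [lra|].
  apply (nonneg_of_derive (fun y => y ^ 2 / 2 - 1 + cos y) (fun y => y - sin y)).
  - derive_tac.
  - intros x hx. generalize (sin_le_id x hx). lra.
  - rewrite cos_0. lra.
  - exact hy. }
destruct (Rle_dec 0 y) as [h|h]; [auto|].
rewrite <- cos_neg. replace (y ^ 2) with ((- y) ^ 2) by ring. apply H. lra.
Qed.

Lemma sin_ge_cubic (y : R) : 0 <= y -> y - y ^ 3 / 6 <= sin y.
Proof.
intros hy. cut (0 <= sin y - y + y ^ 3 / 6); [lra|].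
apply (nonneg_of_derive (fun y => sin y - y + y ^ 3 / 6) (fun y => cos y - 1 + y ^ 2 / 2)).
- derive_tac.
- intros x _. generalize (one_sub_cos_le x). lra.
- rewrite sin_0. lra.
- exact hy.
Qed.

Lemma one_sub_cos_ge (y : R) : 0 <= y -> y ^ 2 / 2 - y ^ 4 / 24 <= 1 - cos y.
Proof.
intros hy. cut (0 <= 1 - cos y - y ^ 2 / 2 + y ^ 4 / 24); [lra|].
apply (nonneg_of_derive (fun y => 1 - cos y - y ^ 2 / 2 + y ^ 4 / 24)
  (fun y => sin y - y + y ^ 3 / 6)).
- derive_tac.
- intros x hx. generalize (sin_ge_cubic x hx). lra.
- rewrite cos_0. lra.
- exact hy.
Qed.

(** The difference has derivative [r (1 + r) (1 - cos y) / ((1 - r) modsq r y)], which is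
    nonnegative and is bounded through [modsq >= (1 - r)^2] and [1 - cos y <= y^2 / 2]. The linear
    coefficient is a share of the mean, the cubic one of the third cumulant. *)
Lemma arg1_bounds (r y : R) : 0 < r < 1 -> 0 <= y ->
  0 <= r / (1 - r) * y - arg1 r y <= r * (1 + r) / (1 - r) ^ 3 * y ^ 3 / 6.
Proof.
intros hr hy.
assert (D : forall x, is_derive (fun y => r / (1 - r) * y - arg1 r y) x
   (r * (1 + r) * (1 - cos x) / ((1 - r) * modsq r x))).
{ intros x. assert (hm := modsq_pos r x hr).
  replace (r * (1 + r) * (1 - cos x) / ((1 - r) * modsq r x))
    with (minus (r / (1 - r)) ((r * cos x - r ^ 2) / modsq r x)).
  - apply (is_derive_minus (fun y => r / (1 - r) * y) (arg1 r)).
    + auto_derive; [exact I|]. field. lra.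
    + apply is_derive_arg1, hr.
  - unfold minus, plus, opp; simpl. unfold modsq in *. field. split; lra. }
assert (A0 : arg1 r 0 = 0).
{ unfold arg1. rewrite sin_0. replace (r * 0 / _) with 0 by (field; rewrite cos_0; lra). apply atan_0. }
split.
- apply (nonneg_of_derive (fun y => r / (1 - r) * y - arg1 r y)
    (fun x => r * (1 + r) * (1 - cos x) / ((1 - r) * modsq r x))); auto.
  + intros x _. assert (hm := modsq_pos r x hr). generalize (COS_bound x). intros hc.
    apply Rdiv_le_0_compat; [|nra]. apply Rmult_le_pos; nra.
  + rewrite A0. lra.
- cut (0 <= r * (1 + r) / (1 - r) ^ 3 * y ^ 3 / 6 - (r / (1 - r) * y - arg1 r y)); [lra|].
  apply (nonneg_of_derive (fun y => r * (1 + r) / (1 - r) ^ 3 * y ^ 3 / 6 - (r / (1 - r) * y - arg1 r y))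
    (fun x => r * (1 + r) / (1 - r) ^ 3 * (x ^ 2 / 2) - r * (1 + r) * (1 - cos x) / ((1 - r) * modsq r x))); auto.
  + intros x _. apply (is_derive_minus (fun y => r * (1 + r) / (1 - r) ^ 3 * y ^ 3 / 6)); [|apply D].
    auto_derive; [splits; nra|]. field. lra.
  + intros x _. assert (hm := modsq_ge r x hr). assert (hc := one_sub_cos_le x).
    assert (hb := COS_bound x).
    assert (h1 : 0 < (1 - r) ^ 2) by (apply pow_lt; lra).
    apply Rle_trans with (r * (1 + r) / (1 - r) ^ 3 * (x ^ 2 / 2)
       - r * (1 + r) / (1 - r) ^ 3 * (1 - cos x)).
    * rewrite <- Rmult_minus_distr_l. apply Rmult_le_pos; [|lra].
      apply Rdiv_le_0_compat; [nra|]. apply pow_lt; lra.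
    * apply Rplus_le_compat_l, Ropp_le_contravar.
      replace (r * (1 + r) * (1 - cos x) / ((1 - r) * modsq r x))
        with (r * (1 + r) * (1 - cos x) / (1 - r) * / modsq r x) by (field; split; nra).
      replace (r * (1 + r) / (1 - r) ^ 3 * (1 - cos x))
        with (r * (1 + r) * (1 - cos x) / (1 - r) * / (1 - r) ^ 2) by (field; lra).
      apply Rmult_le_compat_l; [|apply Rinv_le_contravar; lra].
      apply Rdiv_le_0_compat; [|lra]. apply Rmult_le_pos; nra.
  + rewrite A0. lra.
Qed.

Lemma modsq_cos (r y : R) : modsq r y = (1 - r) ^ 2 + 2 * r * (1 - cos y).
Proof. unfold modsq. ring. Qed.

Lemma lnmod0 (r : R) : 0 < r < 1 -> lnmod r 0 = ln (1 - r).
Proof.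
intros hr. unfold lnmod. rewrite modsq_cos, cos_0.
replace ((1 - r) ^ 2 + 2 * r * (1 - 1)) with ((1 - r) * (1 - r)) by ring.
rewrite ln_mult by lra. lra.
Qed.

Lemma ln_le_sub1 (x : R) : 0 < x -> ln x <= x - 1.
Proof.
intros hx. rewrite <- (ln_exp (x - 1)). apply ln_le; [exact hx|].
generalize (exp_ineq1_le (x - 1)). lra.
Qed.

Lemma lnmod_diff_le (r y : R) : 0 < r < 1 ->
  lnmod r y - lnmod r 0 <= r / (1 - r) ^ 2 * y ^ 2 / 2.
Proof.
intros hr. assert (hm := modsq_pos r y hr). assert (hm0 := modsq_pos r 0 hr).
assert (h1 : 0 < (1 - r) ^ 2) by (apply pow_lt; lra).
unfold lnmod. rewrite <- Rmult_minus_distr_l, <- ln_div by assumption.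
assert (P : 0 < modsq r y / modsq r 0) by (apply Rdiv_lt_0_compat; assumption).
apply Rle_trans with (/ 2 * (modsq r y / modsq r 0 - 1)).
- generalize (ln_le_sub1 _ P). lra.
- rewrite !modsq_cos, cos_0.
  replace (/ 2 * (((1 - r) ^ 2 + 2 * r * (1 - cos y)) / ((1 - r) ^ 2 + 2 * r * (1 - 1)) - 1))
    with (r / (1 - r) ^ 2 * (1 - cos y)) by (field; nra).
  replace (r / (1 - r) ^ 2 * y ^ 2 / 2) with (r / (1 - r) ^ 2 * (y ^ 2 / 2)) by (field; lra).
  apply Rmult_le_compat_l; [|apply one_sub_cos_le].
  apply Rdiv_le_0_compat; lra.
Qed.

(** * Finite sums over lists, and the cosine series of [ln |1 - z|] *)

Lemma sumL_app (L1 L2 : list nat) (h : nat -> R) : sumL (L1 ++ L2) h = sumL L1 h + sumL L2 h.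
Proof. induction L1 as [|j L IH]; simpl; [ring|]. rewrite IH. ring. Qed.

Lemma sumL_seqS (N : nat) (h : nat -> R) :
  sumL (seq 1 (S N)) h = sumL (seq 1 N) h + h (S N).
Proof. rewrite seq_S, sumL_app. simpl. ring. Qed.

Lemma sumL_ext (L : list nat) (h h' : nat -> R) :
  (forall j, In j L -> h j = h' j) -> sumL L h = sumL L h'.
Proof.
induction L as [|j L IH]; simpl; intros H; [reflexivity|]. f_equal; auto.
Qed.

Lemma sumL_le (L : list nat) (h h' : nat -> R) :
  (forall j, In j L -> h j <= h' j) -> sumL L h <= sumL L h'.
Proof.
induction L as [|j L IH]; simpl; intros H; [lra|]. apply Rplus_le_compat; auto.
Qed.

Lemma sumL_scal (L : list nat) (c : R) (h : nat -> R) :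
  sumL L (fun j => c * h j) = c * sumL L h.
Proof. induction L as [|j L IH]; simpl; [ring|]. rewrite IH. ring. Qed.

Lemma sumL_plus (L : list nat) (h h' : nat -> R) :
  sumL L (fun j => h j + h' j) = sumL L h + sumL L h'.
Proof. induction L as [|j L IH]; simpl; [ring|]. rewrite IH. ring. Qed.

Lemma sumL_0 (L : list nat) : sumL L (fun _ => 0) = 0.
Proof. induction L as [|j L IH]; simpl; [ring|]. rewrite IH. ring. Qed.

Lemma sumL_exchange (L M : list nat) (h : nat -> nat -> R) :
  sumL L (fun j => sumL M (fun k => h j k)) = sumL M (fun k => sumL L (fun j => h j k)).
Proof.
induction L as [|j L IH]; simpl; [symmetry; apply sumL_0|].
rewrite IH, <- sumL_plus. reflexivity.
Qed.

Lemma sumL_nonneg (L : list nat) (h : nat -> R) :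
  (forall j, In j L -> 0 <= h j) -> 0 <= sumL L h.
Proof. intros H. rewrite <- (sumL_0 L). apply sumL_le. exact H. Qed.

(* [r * cosdef r y] is the sum over [k >= 1] of [r ^ k * (1 - cos (k y))], and
   [r ^ (K + 1) * cosrem r y K] is its tail after [k = K]. *)
Definition cosdef (r y : R) : R := (1 + r) * (1 - cos y) / ((1 - r) * modsq r y).
Definition cosrem (r y : R) (K : nat) : R :=
  / (1 - r) - (cos (INR (S K) * y) - r * cos (INR K * y)) / modsq r y.

Lemma geom_cos_sum (r y : R) (K : nat) : 0 < r < 1 ->
  sumL (seq 1 K) (fun k => r ^ (k - 1) * (1 - cos (INR k * y))) =
  cosdef r y - r ^ K * cosrem r y K.
Proof.
intros hr. assert (hm := modsq_pos r y hr).
induction K as [|K IH].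
- unfold cosdef, cosrem. simpl sumL. simpl (r ^ 0).
  replace (INR 1 * y) with y by (simpl; ring). replace (INR 0 * y) with 0 by (simpl; ring).
  rewrite cos_0. unfold modsq in *. field. split; lra.
- rewrite sumL_seqS, IH. replace (S K - 1)%nat with K by lia.
  unfold cosrem. rewrite !S_INR.
  replace ((INR K + 1 + 1) * y) with ((INR K + 1) * y + y) by ring.
  replace (INR K * y) with ((INR K + 1) * y - y) by ring.
  set (z := (INR K + 1) * y). rewrite cos_plus, cos_minus. simpl pow.
  unfold modsq in *. field. split; lra.
Qed.

(** The numerator [X] is the real part of [exp (i K y) (exp (i y) - r)], whose modulus squared is
    [modsq r y]. Hence [|X| / modsq <= 1 / sqrt modsq <= 1 / (1 - r)]. *)
Lemma cosrem_bounds (r y : R) (K : nat) : 0 < r < 1 -> 0 <= cosrem r y K <= 2 / (1 - r).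
Proof.
intros hr. assert (hm := modsq_pos r y hr). assert (hg := modsq_ge r y hr).
unfold cosrem. rewrite S_INR. replace ((INR K + 1) * y) with (INR K * y + y) by ring.
set (z := INR K * y). rewrite cos_plus.
set (X := cos z * cos y - sin z * sin y - r * cos z).
assert (HX : X ^ 2 <= modsq r y).
{ rewrite modsq_polar.
  assert (S1 := sin2_cos2 y). assert (S2 := sin2_cos2 z). unfold Rsqr in *.
  assert (E : X ^ 2 + (sin z * (cos y - r) + cos z * sin y) ^ 2 =
     (cos z * cos z + sin z * sin z) * ((cos y - r) ^ 2 + sin y * sin y)) by (unfold X; ring).
  replace (cos z * cos z + sin z * sin z) with 1 in E by lra.
  replace ((1 - r * cos y) ^ 2 + (r * sin y) ^ 2)
    with (1 - 2 * r * cos y + r ^ 2 * (sin y * sin y + cos y * cos y)) by ring.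
  rewrite S1.
  replace ((cos y - r) ^ 2 + sin y * sin y) with
    ((sin y * sin y + cos y * cos y) - 2 * r * cos y + r ^ 2) in E by ring.
  rewrite S1 in E.
  assert (0 <= (sin z * (cos y - r) + cos z * sin y) ^ 2) by apply pow2_ge_0. lra. }
set (m := modsq r y) in *. clearbody X m.
assert (P : 0 < / (1 - r)) by (apply Rinv_0_lt_compat; lra).
assert (B : - / (1 - r) <= X / m <= / (1 - r)).
{ assert (X * (1 - r) <= m) by (generalize (pow2_ge_0 (X - (1 - r))); nra).
  assert (- X * (1 - r) <= m) by (generalize (pow2_ge_0 (X + (1 - r))); nra).
  split; apply Rmult_le_reg_r with (m * (1 - r)); try nra.
  - replace (- / (1 - r) * (m * (1 - r))) with (- m) by (field; lra).
    replace (X / m * (m * (1 - r))) with (X * (1 - r)) by (field; lra). lra.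
  - replace (/ (1 - r) * (m * (1 - r))) with m by (field; lra).
    replace (X / m * (m * (1 - r))) with (X * (1 - r)) by (field; lra). lra. }
unfold Rdiv at 2. lra.
Qed.

(** The left side is a partial sum, with nonnegative terms, of the series for
    [ln |1 - z| - ln (1 - r)]. The series itself is avoided by differentiating in [r]: the
    difference has derivative [r ^ K * cosrem r y K]. *)
Lemma lnmod_diff_ge (r y : R) (K : nat) : 0 < r < 1 ->
  sumL (seq 1 K) (fun k => r ^ k * (1 - cos (INR k * y)) / INR k) <= lnmod r y - lnmod r 0.
Proof.
intros hr. rewrite (lnmod0 r hr).
cut (0 <= lnmod r y - ln (1 - r) - sumL (seq 1 K) (fun k => r ^ k * (1 - cos (INR k * y)) / INR k)); [lra|].
assert (M : forall x, 0 <= x <= r -> 0 < modsq x y).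
{ intros x hx. unfold modsq. generalize (COS_bound y). intros. nra. }
assert (S0 : forall x, is_derive (fun x => sumL (seq 1 K) (fun k => x ^ k * (1 - cos (INR k * y)) / INR k)) x
   (sumL (seq 1 K) (fun k => x ^ (k - 1) * (1 - cos (INR k * y))))).
{ intros x. induction K as [|K IH].
  - simpl. apply (is_derive_const 0).
  - apply is_derive_ext with (fun x => sumL (seq 1 K) (fun k => x ^ k * (1 - cos (INR k * y)) / INR k)
        + x ^ (S K) * (1 - cos (INR (S K) * y)) / INR (S K)).
    + intros t. rewrite sumL_seqS. reflexivity.
    + rewrite sumL_seqS. apply (is_derive_plus (fun x => sumL (seq 1 K) _)); [exact IH|].
      assert (INR (S K) <> 0) by (apply not_0_INR; lia).
      set (c := cos _). auto_derive; [splits|].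
      replace (S K - 1)%nat with K by lia. simpl Nat.pred. field. assumption. }
apply (nonneg_of_derive_upto r
  (fun x => lnmod x y - ln (1 - x) - sumL (seq 1 K) (fun k => x ^ k * (1 - cos (INR k * y)) / INR k))
  (fun x => (x - cos y) / modsq x y + / (1 - x) - sumL (seq 1 K) (fun k => x ^ (k - 1) * (1 - cos (INR k * y))))).
- intros x hx. apply (is_derive_minus (fun x => lnmod x y - ln (1 - x))); [|apply S0].
  assert (hm := M x hx). unfold lnmod, modsq in *. auto_derive; [splits; lra|]. field. split; lra.
(* [geom_cos_sum] requires [0 < r]. At [x = 0] only the term [k = 1] survives, through
   [0 ^ 0 = 1]. *)
- intros x hx. destruct (Req_dec x 0) as [->|h0].
  + destruct K as [|K]; [simpl; unfold modsq; generalize (COS_bound y); intros; field_simplify; lra|].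
    assert (E : sumL (seq 1 (S K)) (fun k => 0 ^ (k - 1) * (1 - cos (INR k * y))) = 1 - cos y).
    { clear. induction K as [|K IH].
      - simpl. rewrite ?Rmult_1_l. ring.
      - rewrite sumL_seqS, IH. replace (S (S K) - 1)%nat with (S K) by lia. simpl. ring. }
    rewrite E. unfold modsq. apply Req_le. field.
  + assert (hx' : 0 < x < 1) by lra. rewrite (geom_cos_sum x y K hx').
    assert (hm := M x hx). destruct (cosrem_bounds x y K hx') as [hc _].
    assert (0 < x ^ K) by (apply pow_lt; lra).
    replace ((x - cos y) / modsq x y + / (1 - x)) with (cosdef x y).
    * nra.
    * unfold cosdef, modsq in *. field. split; lra.
- unfold lnmod, modsq. rewrite Rminus_0_r, ln_1.
  replace (1 - 2 * 0 * cos y + 0 ^ 2) with 1 by ring. rewrite ln_1.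
  replace (sumL _ _) with 0; [lra|].
  clear. induction K as [|K IH]; [reflexivity|]. rewrite sumL_seqS, <- IH. simpl.
  unfold Rdiv. ring.
- lra.
Qed.

(** * Cumulant sums *)

(* [4 sinh (t/2) ^ 2], which is [(1 - r) ^ 2 / r] for [r = exp (- t)]. *)
Definition kap (t : R) : R := exp t + exp (- t) - 2.

Lemma kap_ge (t : R) : 0 <= t -> t ^ 2 + t ^ 4 / 12 + t ^ 6 / 360 <= kap t.
Proof.
assert (C0 : forall t, 0 <= t -> 0 <= exp t + exp (- t) - 2).
{ intros x _. assert (H := exp_neg_inv x). generalize (exp_pos x) (exp_pos (- x)).
  set (a := exp x) in *. set (b := exp (- x)) in *. intros. clearbody a b.
  assert (0 <= (a - b) ^ 2) by apply pow2_ge_0. nra. }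
assert (S1 : forall t, 0 <= t -> 0 <= exp t - exp (- t) - 2 * t).
{ apply (nonneg_of_derive _ (fun t => exp t + exp (- t) - 2)); [derive_tac|exact C0|].
  rewrite Ropp_0, exp_0. lra. }
assert (C1 : forall t, 0 <= t -> 0 <= exp t + exp (- t) - 2 - t ^ 2).
{ apply (nonneg_of_derive _ (fun t => exp t - exp (- t) - 2 * t)); [derive_tac|exact S1|].
  rewrite Ropp_0, exp_0. lra. }
assert (S2 : forall t, 0 <= t -> 0 <= exp t - exp (- t) - 2 * t - t ^ 3 / 3).
{ apply (nonneg_of_derive _ (fun t => exp t + exp (- t) - 2 - t ^ 2)); [derive_tac|exact C1|].
  rewrite Ropp_0, exp_0. lra. }
assert (C2 : forall t, 0 <= t -> 0 <= exp t + exp (- t) - 2 - t ^ 2 - t ^ 4 / 12).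
{ apply (nonneg_of_derive _ (fun t => exp t - exp (- t) - 2 * t - t ^ 3 / 3)); [derive_tac|exact S2|].
  rewrite Ropp_0, exp_0. lra. }
assert (S3 : forall t, 0 <= t -> 0 <= exp t - exp (- t) - 2 * t - t ^ 3 / 3 - t ^ 5 / 60).
{ apply (nonneg_of_derive _ (fun t => exp t + exp (- t) - 2 - t ^ 2 - t ^ 4 / 12)); [derive_tac|exact C2|].
  rewrite Ropp_0, exp_0. lra. }
assert (C3 : forall t, 0 <= t -> 0 <= exp t + exp (- t) - 2 - t ^ 2 - t ^ 4 / 12 - t ^ 6 / 360).
{ apply (nonneg_of_derive _ (fun t => exp t - exp (- t) - 2 * t - t ^ 3 / 3 - t ^ 5 / 60)); [derive_tac|exact S3|].
  rewrite Ropp_0, exp_0. lra. }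
intros h. unfold kap. generalize (C3 t h). lra.
Qed.

Lemma exp_le_inv_one_sub (t : R) : 0 <= t < 1 -> exp t <= / (1 - t).
Proof.
intros h. apply Rmult_le_reg_r with (1 - t); [lra|]. rewrite Rinv_l by lra.
assert (H := exp_neg_inv t). generalize (exp_ineq1_le (- t)) (exp_pos t). nra.
Qed.

(** Replacing the Taylor coefficient 1/12 by 1/11 absorbs the remainder: after four derivatives the
    claim reads [exp t + exp (- t) <= 24 / 11]. The range covers [t = k s] for [k <= 5] and
    [s <= 1/18]. *)
Lemma kap_le (t : R) : 0 <= t <= 3 / 10 -> kap t <= t ^ 2 * (1 + t ^ 2 / 11).
Proof.
assert (C0 : forall t, 0 <= t <= 3 / 10 -> 0 <= 2 + 2 / 11 - exp t - exp (- t)).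
{ intros x hx. assert (H := exp_neg_inv x).
  assert (E : exp (3 / 10) <= 137 / 100).
  { replace (3 / 10) with (3 / 40 + 3 / 40 + (3 / 40 + 3 / 40)) by lra. rewrite !exp_plus.
    assert (Q := exp_le_inv_one_sub (3 / 40)). assert (P := exp_pos (3 / 40)).
    set (e := exp (3 / 40)) in *. assert (e <= 40 / 37) by (apply Rle_trans with (/ (1 - 3 / 40)); [apply Q; lra|lra]).
    assert (e * e <= 117 / 100) by (apply Rle_trans with (40 / 37 * (40 / 37)); [apply Rmult_le_compat; lra|lra]).
    assert (0 < e * e) by (apply Rmult_lt_0_compat; lra).
    apply Rle_trans with (117 / 100 * (117 / 100)); [apply Rmult_le_compat; lra|]. lra. }
  assert (F : exp x <= exp (3 / 10)).
  { destruct (Req_dec x (3 / 10)) as [->|]; [lra|]. apply Rlt_le, exp_increasing. lra. }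
  assert (G := exp_ineq1_le x). assert (P := exp_pos (- x)).
  set (a := exp x) in *. set (b := exp (- x)) in *. clearbody a b.
  assert (1 <= a) by lra. assert (b <= 1) by nra.
  assert (a * (a + b - 2) = (a - 1) ^ 2) by (replace (a * (a + b - 2)) with (a * a + a * b - 2 * a) by ring; rewrite H; ring).
  assert ((a - 1) ^ 2 <= 37 / 100 * (37 / 100)) by nra.
  assert (a + b - 2 <= 2 / 11); [|lra].
  destruct (Rle_dec (a + b - 2) (2 / 11)); [assumption|]. nra. }
assert (S1 : forall t, 0 <= t <= 3 / 10 -> 0 <= (2 + 2 / 11) * t - exp t + exp (- t)).
{ apply (nonneg_of_derive_upto _ _ (fun t => 2 + 2 / 11 - exp t - exp (- t))); [derive_tac|exact C0|].
  rewrite Ropp_0, exp_0. lra. }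
assert (C1 : forall t, 0 <= t <= 3 / 10 -> 0 <= 2 + 12 / 11 * t ^ 2 - exp t - exp (- t)).
{ apply (nonneg_of_derive_upto _ _ (fun t => (2 + 2 / 11) * t - exp t + exp (- t))); [derive_tac|exact S1|].
  rewrite Ropp_0, exp_0. lra. }
assert (S2 : forall t, 0 <= t <= 3 / 10 -> 0 <= 2 * t + 4 / 11 * t ^ 3 - exp t + exp (- t)).
{ apply (nonneg_of_derive_upto _ _ (fun t => 2 + 12 / 11 * t ^ 2 - exp t - exp (- t))); [derive_tac|exact C1|].
  rewrite Ropp_0, exp_0. lra. }
assert (C2 : forall t, 0 <= t <= 3 / 10 -> 0 <= 2 + t ^ 2 + / 11 * t ^ 4 - exp t - exp (- t)).
{ apply (nonneg_of_derive_upto _ _ (fun t => 2 * t + 4 / 11 * t ^ 3 - exp t + exp (- t))); [derive_tac|exact S2|].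
  rewrite Ropp_0, exp_0. lra. }
intros h. unfold kap. generalize (C2 t h). lra.
Qed.

Lemma exp_neg_lt1 (t : R) : 0 < t -> 0 < exp (- t) < 1.
Proof.
intros h. split; [apply exp_pos|]. rewrite <- exp_0. apply exp_increasing. lra.
Qed.

(** The quotient is [coth (t / 2) = 2 / t + t / 6 - ...]; this lemma and the next bracket it between
    the first two truncations of its Laurent series. *)
Lemma coth_ge (t : R) : 0 < t -> 2 / t <= (1 + exp (- t)) / (1 - exp (- t)).
Proof.
intros h. assert (hr := exp_neg_lt1 t h).
assert (F : forall t, 0 <= t -> 0 <= t * (1 + exp (- t)) - 2 * (1 - exp (- t))).
{ apply (nonneg_of_derive _ (fun t => 1 - (1 + t) * exp (- t))); [derive_tac| |].
  - intros x hx. assert (H := exp_neg_inv x). generalize (exp_ineq1_le x) (exp_pos (- x)). nra.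
  - rewrite Ropp_0, exp_0. lra. }
specialize (F t (Rlt_le _ _ h)).
apply Rmult_le_reg_r with (t * (1 - exp (- t))); [nra|].
replace (2 / t * (t * (1 - exp (- t)))) with (2 * (1 - exp (- t))) by (field; lra).
replace ((1 + exp (- t)) / (1 - exp (- t)) * (t * (1 - exp (- t)))) with (t * (1 + exp (- t))) by (field; lra).
lra.
Qed.

Lemma coth_le (t : R) : 0 < t -> (1 + exp (- t)) / (1 - exp (- t)) <= 2 / t + t / 6.
Proof.
intros h. assert (hr := exp_neg_lt1 t h).
assert (F3 : forall t, 0 <= t -> 0 <= exp t * (t / 3 - 1 / 3) + 1 / 3).
{ apply (nonneg_of_derive _ (fun t => exp t * (t / 3))); [derive_tac| |].
  - intros x hx. generalize (exp_pos x). nra.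
  - rewrite exp_0. lra. }
assert (F2 : forall t, 0 <= t -> 0 <= exp t * (t / 3 - 2 / 3) + 2 / 3 + t / 3).
{ apply (nonneg_of_derive _ (fun t => exp t * (t / 3 - 1 / 3) + 1 / 3)); [derive_tac|exact F3|].
  rewrite exp_0. lra. }
assert (F1 : forall t, 0 <= t -> 0 <= exp t * (t / 3 - 1) + 1 + 2 * t / 3 + t ^ 2 / 6).
{ apply (nonneg_of_derive _ (fun t => exp t * (t / 3 - 2 / 3) + 2 / 3 + t / 3)); [derive_tac|exact F2|].
  rewrite exp_0. lra. }
assert (F : forall t, 0 <= t -> 0 <= (2 + t ^ 2 / 6) * (1 - exp (- t)) - t * (1 + exp (- t))).
{ apply (nonneg_of_derive _ (fun t => t / 3 - 1 + exp (- t) * (1 + 2 * t / 3 + t ^ 2 / 6))); [derive_tac| |].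
  - intros x hx. specialize (F1 x hx). assert (H := exp_neg_inv x). assert (P := exp_pos (- x)).
    assert (Q := Rmult_le_pos _ _ (Rlt_le _ _ P) F1).
    replace (exp (- x) * (exp x * (x / 3 - 1) + 1 + 2 * x / 3 + x ^ 2 / 6)) with
      ((exp x * exp (- x)) * (x / 3 - 1) + exp (- x) * (1 + 2 * x / 3 + x ^ 2 / 6)) in Q by field.
    rewrite H in Q. lra.
  - rewrite Ropp_0, exp_0. lra. }
specialize (F t (Rlt_le _ _ h)).
apply Rmult_le_reg_r with (t * (1 - exp (- t))); [nra|].
replace ((1 + exp (- t)) / (1 - exp (- t)) * (t * (1 - exp (- t)))) with (t * (1 + exp (- t))) by (field; lra).
replace ((2 / t + t / 6) * (t * (1 - exp (- t)))) with ((2 + t ^ 2 / 6) * (1 - exp (- t))) by (field; lra).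
lra.
Qed.

(* [gk r] is the sum of [j ^ k * r ^ j] over [j >= 1]. *)
Definition g0 (r : R) := r / (1 - r).
Definition g1 (r : R) := r / (1 - r) ^ 2.
Definition g2 (r : R) := r * (1 + r) / (1 - r) ^ 3.
Definition g3 (r : R) := r * (1 + 4 * r + r ^ 2) / (1 - r) ^ 4.

Lemma pow_sum0 (r : R) (N : nat) : 0 < r < 1 ->
  sumL (seq 1 N) (fun j => r ^ j) = g0 r - r ^ N * g0 r.
Proof.
intros h. induction N as [|N IH]; [simpl; ring|]. rewrite sumL_seqS, IH.
unfold g0. simpl pow. field. lra.
Qed.

Lemma pow_sum1 (r : R) (N : nat) : 0 < r < 1 ->
  sumL (seq 1 N) (fun j => INR j * r ^ j) = g1 r - r ^ N * (INR N * g0 r + g1 r).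
Proof.
intros h. induction N as [|N IH]; [simpl; ring|]. rewrite sumL_seqS, IH.
unfold g0, g1. rewrite S_INR. simpl pow. field. lra.
Qed.

Lemma pow_sum2 (r : R) (N : nat) : 0 < r < 1 ->
  sumL (seq 1 N) (fun j => INR j ^ 2 * r ^ j) =
  g2 r - r ^ N * (INR N ^ 2 * g0 r + 2 * INR N * g1 r + g2 r).
Proof.
intros h. induction N as [|N IH]; [simpl; ring|]. rewrite sumL_seqS, IH.
unfold g0, g1, g2. rewrite S_INR. simpl pow. field. lra.
Qed.

Lemma pow_sum3 (r : R) (N : nat) : 0 < r < 1 ->
  sumL (seq 1 N) (fun j => INR j ^ 3 * r ^ j) =
  g3 r - r ^ N * (INR N ^ 3 * g0 r + 3 * INR N ^ 2 * g1 r + 3 * INR N * g2 r + g3 r).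
Proof.
intros h. induction N as [|N IH]; [simpl; ring|]. rewrite sumL_seqS, IH.
unfold g0, g1, g2, g3. rewrite S_INR. simpl pow. field. lra.
Qed.

Lemma g_pos (r : R) : 0 < r < 1 -> 0 < g0 r /\ 0 < g1 r /\ 0 < g2 r /\ 0 < g3 r.
Proof.
intros h. unfold g0, g1, g2, g3.
splits; (apply Rdiv_lt_0_compat; [nra|]); try apply pow_lt; lra.
Qed.

Lemma sq_one_sub_exp (t : R) : (1 - exp (- t)) ^ 2 = exp (- t) * kap t.
Proof.
unfold kap. assert (H := exp_neg_inv t).
replace (exp (- t) * (exp t + exp (- t) - 2))
  with ((exp t * exp (- t)) + exp (- t) ^ 2 - 2 * exp (- t)) by ring.
rewrite H. ring.
Qed.

Lemma kap_pos (t : R) : 0 < t -> t ^ 2 * (1 + t ^ 2 / 12) <= kap t /\ 0 < kap t.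
Proof.
intros h. assert (H := kap_ge t (Rlt_le _ _ h)).
assert (0 < t ^ 2) by (apply pow_lt; lra). assert (0 < t ^ 4) by (apply pow_lt; lra).
assert (0 < t ^ 6) by (apply pow_lt; lra).
assert (t ^ 2 * (1 + t ^ 2 / 12) = t ^ 2 + t ^ 4 / 12) by field. lra.
Qed.

Lemma g1_exp (t : R) : 0 < t -> g1 (exp (- t)) = / kap t.
Proof.
intros h. assert (hr := exp_neg_lt1 t h). destruct (kap_pos t h) as [_ P].
unfold g1. rewrite sq_one_sub_exp. field. lra.
Qed.

Lemma g1_le (t : R) : 0 < t -> g1 (exp (- t)) <= 1 / t ^ 2.
Proof.
intros h. rewrite (g1_exp t h). destruct (kap_pos t h) as [H P].
assert (0 < t ^ 2) by (apply pow_lt; lra).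
unfold Rdiv. rewrite Rmult_1_l. apply Rinv_le_contravar; nra.
Qed.

(** [g2 = g1 coth (t / 2)], and the corrections cancel exactly: [2 / t + t / 6] is [2 / t] times
    [1 + t^2 / 12], the factor also present in the lower bound for [kap]. *)
Lemma g2_le (t : R) : 0 < t -> g2 (exp (- t)) <= 2 / t ^ 3.
Proof.
intros h. assert (hr := exp_neg_lt1 t h). destruct (kap_pos t h) as [H P].
assert (0 < t ^ 2) by (apply pow_lt; lra).
replace (g2 (exp (- t))) with (g1 (exp (- t)) * ((1 + exp (- t)) / (1 - exp (- t))))
  by (unfold g1, g2; field; lra).
rewrite (g1_exp t h).
apply Rle_trans with (/ (t ^ 2 * (1 + t ^ 2 / 12)) * (2 / t + t / 6)).
- apply Rmult_le_compat.
  + left. apply Rinv_0_lt_compat. exact P.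
  + apply Rdiv_le_0_compat; lra.
  + apply Rinv_le_contravar; nra.
  + apply coth_le, h.
- apply Req_le. field. split; nra.
Qed.

Lemma g3_le (t : R) : 0 < t -> g3 (exp (- t)) <= (612 / 100) / t ^ 4.
Proof.
intros h. assert (hr := exp_neg_lt1 t h). destruct (kap_pos t h) as [_ P].
replace (g3 (exp (- t))) with (g1 (exp (- t)) + 6 * g1 (exp (- t)) ^ 2)
  by (unfold g1, g3; field; lra).
rewrite (g1_exp t h).
assert (H := kap_ge t (Rlt_le _ _ h)).
assert (hv : 0 < t ^ 2) by (apply pow_lt; lra).
set (v := t ^ 2) in *.
replace (t ^ 4) with (v ^ 2) in * by (unfold v; ring).
replace (t ^ 6) with (v ^ 3) in * by (unfold v; ring).
set (T := v + v ^ 2 / 12 + v ^ 3 / 360) in *.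
assert (hT : 0 < T) by (assert (0 < v ^ 2) by (apply pow_lt; lra); assert (0 < v ^ 3) by (apply pow_lt; lra); unfold T; lra).
assert (I : / kap t <= / T) by (apply Rinv_le_contravar; lra).
assert (J : 0 < / kap t) by (apply Rinv_0_lt_compat; lra).
apply Rle_trans with (/ T + 6 * (/ T) ^ 2); [nra|].
apply Rmult_le_reg_r with (T ^ 2 * v ^ 2); [apply Rmult_lt_0_compat; apply pow_lt; assumption|].
replace ((/ T + 6 * (/ T) ^ 2) * (T ^ 2 * v ^ 2)) with ((T + 6) * v ^ 2) by (field; lra).
replace (612 / 100 / v ^ 2 * (T ^ 2 * v ^ 2)) with (612 / 100 * T ^ 2) by (field; lra).
replace (T ^ 2) with (v ^ 2 * (1 + v / 12 + v ^ 2 / 360) ^ 2) by (unfold T; field).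
rewrite (Rmult_comm (T + 6)).
replace (612 / 100 * (v ^ 2 * (1 + v / 12 + v ^ 2 / 360) ^ 2)) with
  (v ^ 2 * (612 / 100 * (1 + v / 12 + v ^ 2 / 360) ^ 2)) by ring.
apply Rmult_le_compat_l; [apply pow2_ge_0|]. unfold T.
clearbody v. clear - hv.
(* The difference of the two sides is a quartic in [v] whose only negative coefficient is that of
   [v^2]; these two squares absorb it. The margin of 2 per cent over the leading term [6 / t^4]
   makes room for them. *)
assert (H1 := pow2_ge_0 (v ^ 2 - 503 / 10)).
assert (H2 := Rmult_le_pos _ _ (Rlt_le _ _ hv) (pow2_ge_0 (v - 19))).
assert (H3 := pow_lt v 2 hv). assert (H4 := pow_lt v 3 hv). lra.
Qed.

(** Five exact terms sum to 5269/3600, and the rest telescopes through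
    [1 / k^2 <= 1 / (k - 1/2) - 1 / (k + 1/2)], at most 2/11. The slightly larger 400/243 is
    convenient because [3 * 400/243 * 18^2 = 1600]. *)
Lemma sum_inv_sq_le (K : nat) : sumL (seq 1 K) (fun k => 1 / INR k ^ 2) <= 400 / 243.
Proof.
assert (H : forall K, sumL (seq 1 (5 + K)) (fun k => 1 / INR k ^ 2) <=
   5269 / 3600 + 2 / 11 - 1 / (INR K + 11 / 2)).
{ clear. induction K as [|K IH].
  - simpl. lra.
  - rewrite Nat.add_succ_r, sumL_seqS, (S_INR K).
    replace (INR (S (5 + K))) with (INR K + 6) by (replace (S (5 + K)) with (K + 6)%nat by lia; rewrite plus_INR; simpl; ring).
    assert (hK := pos_INR K). set (x := INR K) in *. clearbody x.
    assert (1 / (x + 6) ^ 2 <= 1 / (x + 11 / 2) - 1 / (x + 1 + 11 / 2)); [|lra].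
    replace (1 / (x + 11 / 2) - 1 / (x + 1 + 11 / 2)) with (/ ((x + 11 / 2) * (x + 13 / 2))).
    + unfold Rdiv at 1. rewrite Rmult_1_l. apply Rinv_le_contravar; nra.
    + field. lra. }
assert (M : forall K, sumL (seq 1 K) (fun k => 1 / INR k ^ 2) <= sumL (seq 1 (5 + K)) (fun k => 1 / INR k ^ 2)).
{ intros n. rewrite (Nat.add_comm 5 n), seq_app, sumL_app.
  assert (0 <= sumL (seq (1 + n) 5) (fun k => 1 / INR k ^ 2)); [|lra].
  apply sumL_nonneg. intros j hj. apply in_seq in hj.
  apply Rdiv_le_0_compat; [lra|]. apply pow_lt, lt_0_INR. lia. }
apply Rle_trans with (1 := M K), Rle_trans with (1 := H K).
assert (0 < 1 / (INR K + 11 / 2)).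
{ assert (hK := pos_INR K). apply Rdiv_lt_0_compat; lra. }
lra.
Qed.

Lemma exp_ge_cube (z : R) : 0 <= z -> z ^ 3 / 6 <= exp z.
Proof.
assert (H1 : forall t, 0 <= t -> 0 <= exp t - t).
{ intros t _. generalize (exp_ineq1_le t). lra. }
assert (H2 : forall t, 0 <= t -> 0 <= exp t - t ^ 2 / 2).
{ apply (nonneg_of_derive _ (fun t => exp t - t)); [derive_tac|exact H1|]. rewrite exp_0. lra. }
assert (H3 : forall t, 0 <= t -> 0 <= exp t - t ^ 3 / 6).
{ apply (nonneg_of_derive _ (fun t => exp t - t ^ 2 / 2)); [derive_tac|exact H2|]. rewrite exp_0. lra. }
intros h. generalize (H3 z h). lra.
Qed.

Lemma le_of_le_add_div (x y C : R) :
  (forall K, (1 <= K)%nat -> x <= y + C / INR K) -> x <= y.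
Proof.
intros H. destruct (Rle_dec x y) as [h|h]; [exact h|exfalso].
assert (D : 0 < x - y) by lra.
destruct (INR_unbounded (Rabs C / (x - y))) as [K hK].
assert (P := Rabs_pos C). assert (Q := Rle_abs C).
assert (hK0 : 0 < INR K).
{ apply Rle_lt_trans with (2 := hK). apply Rdiv_le_0_compat; lra. }
assert (hK1 : (1 <= K)%nat) by (apply (INR_lt 0) in hK0; lia).
specialize (H K hK1).
assert (Rabs C < INR K * (x - y)).
{ replace (Rabs C) with (Rabs C / (x - y) * (x - y)) by (field; lra).
  apply Rmult_lt_compat_r; lra. }
assert (C / INR K < x - y).
{ apply Rmult_lt_reg_r with (INR K); [lra|].
  replace (C / INR K * INR K) with C by (field; lra). lra. }
lra.
Qed.

Lemma rho_pow (s : R) (j k : nat) : rho s j ^ k = exp (- (INR j * (INR k * s))).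
Proof.
unfold rho. induction k as [|k IH].
- simpl. rewrite Rmult_0_l, Rmult_0_r, Ropp_0, exp_0. reflexivity.
- rewrite S_INR. simpl pow. rewrite IH, <- exp_plus. f_equal. ring.
Qed.

(* Summation over [j] first, for each power [rho_j ^ k], exhibits the factor zeta(2). *)
Lemma double_sum_le (p : nat) (g C : R -> R) (B : R) : 0 <= B ->
  (forall r K, 0 < r < 1 -> (1 <= K)%nat ->
     g r <= sumL (seq 1 K) (fun k => INR k ^ p * r ^ k) + r ^ K * INR K ^ 2 * C r) ->
  (forall r, 0 < r < 1 -> 0 <= C r) ->
  (forall t N, 0 < t -> sumL (seq 1 N) (fun j => INR j ^ S p * exp (- t) ^ j) <= B / t ^ (p + 2)) ->
  forall N s, 0 < s -> sumL (seq 1 N) (fun j => INR j ^ S p * g (rho s j)) <= 400 / 243 * B / s ^ (p + 2).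
Proof.
intros hB hg hC hS N s hs.
apply (le_of_le_add_div _ _ (sumL (seq 1 N) (fun j => INR j ^ S p * (6 / (INR j * s) ^ 3 * C (rho s j))))).
(* Cutting the expansion of each [g (rho s j)] at [K] costs [O (1 / K)] for fixed [N], because
   [exp z >= z^3 / 6] gives [rho_j^K K^2 <= 6 / (K (j s)^3)]. Then [K] tends to infinity. *)
intros K hK. assert (hK0 : 0 < INR K) by (apply lt_0_INR; lia).
apply Rle_trans with (sumL (seq 1 N) (fun j =>
   sumL (seq 1 K) (fun k => INR j ^ S p * (INR k ^ p * rho s j ^ k)) +
     / INR K * (INR j ^ S p * (6 / (INR j * s) ^ 3 * C (rho s j))))).
- apply sumL_le. intros j hj. apply in_seq in hj.
  assert (hj0 : 0 < INR j) by (apply lt_0_INR; lia).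
  assert (hr := rho_bounds s j hs ltac:(lia)).
  rewrite sumL_scal.
  replace (/ INR K * (INR j ^ S p * (6 / (INR j * s) ^ 3 * C (rho s j)))) with
    (INR j ^ S p * (6 / (INR j * s) ^ 3 * / INR K * C (rho s j))) by ring.
  rewrite <- Rmult_plus_distr_l.
  apply Rmult_le_compat_l; [apply pow_le; lra|].
  apply Rle_trans with (1 := hg _ K hr hK).
  apply Rplus_le_compat_l, Rmult_le_compat_r; [apply hC, hr|].
  rewrite rho_pow.
  set (t := INR j * s). assert (ht : 0 < t) by (apply Rmult_lt_0_compat; lra).
  replace (INR j * (INR K * s)) with (INR K * t) by (unfold t; ring).
  assert (X := exp_ge_cube (INR K * t) ltac:(nra)). assert (Y := exp_neg_inv (INR K * t)).
  assert (Z := exp_pos (- (INR K * t))).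
  set (x := INR K) in *. clearbody x t.
  apply Rmult_le_reg_r with (x * t ^ 3 / 6); [apply Rdiv_lt_0_compat; [apply Rmult_lt_0_compat; [|apply pow_lt]|]; lra|].
  replace (6 / t ^ 3 * / x * (x * t ^ 3 / 6)) with 1 by (field; lra).
  rewrite <- Y.
  replace (exp (- (x * t)) * x ^ 2 * (x * t ^ 3 / 6)) with ((x * t) ^ 3 / 6 * exp (- (x * t))) by field.
  apply Rmult_le_compat_r; lra.
- rewrite sumL_plus, sumL_scal. unfold Rdiv at 4. rewrite (Rmult_comm (/ INR K)).
  apply Rplus_le_compat_r.
  rewrite sumL_exchange.
  (* At fixed [k] the sum over [j] is at most [B / (k s)^(p+2)]; the weight [k^p] leaves
     [1 / k^2]. *)
  apply Rle_trans with (sumL (seq 1 K) (fun k => B / s ^ (p + 2) * (1 / INR k ^ 2))).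
  + apply sumL_le. intros k hk. apply in_seq in hk.
    assert (hk0 : 0 < INR k) by (apply lt_0_INR; lia).
    apply Rle_trans with (INR k ^ p * (B / (INR k * s) ^ (p + 2))).
    * apply Rle_trans with (INR k ^ p * sumL (seq 1 N) (fun j => INR j ^ S p * exp (- (INR k * s)) ^ j)).
      -- rewrite <- sumL_scal. apply Req_le, sumL_ext. intros j _.
         replace (exp (- (INR k * s))) with (rho s k) by reflexivity.
         rewrite !rho_pow. replace (INR k * (INR j * s)) with (INR j * (INR k * s)) by ring. ring.
      -- apply Rmult_le_compat_l; [apply pow_le; lra|]. apply hS. nra.
    * apply Req_le. rewrite Rpow_mult_distr, (pow_add (INR k)).
      field. splits; try (apply pow_nonzero; lra); lra.
  + rewrite sumL_scal.
    replace (400 / 243 * B / s ^ (p + 2)) with (B / s ^ (p + 2) * (400 / 243)) by (field; apply pow_nonzero; lra).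
    apply Rmult_le_compat_l; [|apply sum_inv_sq_le].
    apply Rdiv_le_0_compat; [lra|apply pow_lt; lra].
Qed.

(** The sums for mean, variance and third cumulant are the cases [p = 0, 1, 2] of [double_sum_le],
    with [B] taken from [g1_le], [g2_le] and [g3_le]. *)
Lemma sum_g0_le (N : nat) (s : R) : 0 < s ->
  sumL (seq 1 N) (fun j => INR j * g0 (rho s j)) <= 400 / 243 / s ^ 2.
Proof.
intros hs.
assert (H := double_sum_le 0 g0 g0 1). simpl (0 + 2)%nat in H.
replace (400 / 243 / s ^ 2) with (400 / 243 * 1 / s ^ 2) by (field; lra).
rewrite (sumL_ext _ _ (fun j => INR j ^ 1 * g0 (rho s j))) by (intros; simpl; ring).
apply H; [lra| | | |exact hs].
- intros r K hr hK. rewrite (sumL_ext _ _ (fun k => r ^ k)) by (intros; simpl; ring).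
  rewrite pow_sum0 by exact hr. destruct (g_pos r hr) as [P _].
  assert (0 < r ^ K) by (apply pow_lt; lra).
  assert (1 <= INR K) by (apply (le_INR 1); lia).
  assert (1 <= INR K ^ 2) by nra. assert (0 < r ^ K * g0 r) by nra. nra.
- intros r hr. destruct (g_pos r hr). lra.
- intros t n ht. rewrite (sumL_ext _ _ (fun j => INR j * exp (- t) ^ j)) by (intros; simpl; ring).
  assert (hr := exp_neg_lt1 t ht). rewrite pow_sum1 by exact hr.
  destruct (g_pos _ hr) as [P [Q _]]. assert (0 < exp (- t) ^ n) by (apply pow_lt; lra).
  assert (hn := pos_INR n). apply Rle_trans with (2 := g1_le t ht).
  assert (0 <= exp (- t) ^ n * (INR n * g0 (exp (- t)) + g1 (exp (- t)))); [|lra].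
  apply Rmult_le_pos; [lra|]. nra.
Qed.

Lemma sum_g1_le (N : nat) (s : R) : 0 < s ->
  sumL (seq 1 N) (fun j => INR j ^ 2 * g1 (rho s j)) <= 800 / 243 / s ^ 3.
Proof.
intros hs.
replace (800 / 243 / s ^ 3) with (400 / 243 * 2 / s ^ (1 + 2)) by (simpl; field; lra).
apply (double_sum_le 1 g1 (fun r => g0 r + g1 r)); [lra| | | |exact hs].
- intros r K hr hK. rewrite (sumL_ext _ _ (fun k => INR k * r ^ k)) by (intros; simpl; ring).
  rewrite pow_sum1 by exact hr. destruct (g_pos r hr) as [P [Q _]].
  assert (0 < r ^ K) by (apply pow_lt; lra).
  assert (1 <= INR K) by (apply (le_INR 1); lia).
  assert (INR K <= INR K ^ 2) by nra.
  assert (M1 : INR K * g0 r <= INR K ^ 2 * g0 r) by (apply Rmult_le_compat_r; lra).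
  assert (M2 : 1 * g1 r <= INR K ^ 2 * g1 r) by (apply Rmult_le_compat_r; lra).
  assert (M : r ^ K * (INR K * g0 r + g1 r) <= r ^ K * (INR K ^ 2 * (g0 r + g1 r)))
    by (apply Rmult_le_compat_l; lra).
  rewrite Rmult_assoc. lra.
- intros r hr. destruct (g_pos r hr). lra.
- intros t n ht. simpl (1 + 2)%nat.
  assert (hr := exp_neg_lt1 t ht). rewrite pow_sum2 by exact hr.
  destruct (g_pos _ hr) as [P [Q [S _]]]. assert (0 < exp (- t) ^ n) by (apply pow_lt; lra).
  assert (hn := pos_INR n). apply Rle_trans with (2 := g2_le t ht).
  assert (0 <= exp (- t) ^ n * (INR n ^ 2 * g0 (exp (- t)) + 2 * INR n * g1 (exp (- t)) + g2 (exp (- t)))); [|lra].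
  apply Rmult_le_pos; [lra|]. assert (0 <= INR n ^ 2) by (apply pow_le; lra).
  generalize dependent (g3 (exp (- t))). generalize dependent (g2 (exp (- t))).
  generalize dependent (g1 (exp (- t))). generalize dependent (g0 (exp (- t))). intros.
  repeat apply Rplus_le_le_0_compat; try (repeat apply Rmult_le_pos); lra.
Qed.

Lemma sum_g2_le (N : nat) (s : R) : 0 < s ->
  sumL (seq 1 N) (fun j => INR j ^ 3 * g2 (rho s j)) <= 400 / 243 * (612 / 100) / s ^ 4.
Proof.
intros hs. change (s ^ 4) with (s ^ (2 + 2)).
apply (double_sum_le 2 g2 (fun r => g0 r + 2 * g1 r + g2 r)); [lra| | | |exact hs].
- intros r K hr hK. rewrite pow_sum2 by exact hr. destruct (g_pos r hr) as [P [Q [S _]]].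
  assert (0 < r ^ K) by (apply pow_lt; lra).
  assert (1 <= INR K) by (apply (le_INR 1); lia).
  assert (INR K <= INR K ^ 2) by nra.
  assert (M1 : INR K * g1 r <= INR K ^ 2 * g1 r) by (apply Rmult_le_compat_r; lra).
  assert (M2 : 1 * g2 r <= INR K ^ 2 * g2 r) by (apply Rmult_le_compat_r; lra).
  assert (M : r ^ K * (INR K ^ 2 * g0 r + 2 * INR K * g1 r + g2 r) <=
    r ^ K * (INR K ^ 2 * (g0 r + 2 * g1 r + g2 r))) by (apply Rmult_le_compat_l; lra).
  rewrite Rmult_assoc. lra.
- intros r hr. destruct (g_pos r hr). lra.
- intros t n ht. simpl (2 + 2)%nat.
  assert (hr := exp_neg_lt1 t ht). rewrite pow_sum3 by exact hr.
  destruct (g_pos _ hr) as [P [Q [S T]]]. assert (0 < exp (- t) ^ n) by (apply pow_lt; lra).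
  assert (hn := pos_INR n). apply Rle_trans with (2 := g3_le t ht).
  assert (0 <= exp (- t) ^ n * (INR n ^ 3 * g0 (exp (- t)) + 3 * INR n ^ 2 * g1 (exp (- t)) + 3 * INR n * g2 (exp (- t)) + g3 (exp (- t)))); [|lra].
  apply Rmult_le_pos; [lra|]. assert (0 <= INR n ^ 2) by (apply pow_le; lra).
  generalize dependent (g3 (exp (- t))). generalize dependent (g2 (exp (- t))).
  generalize dependent (g1 (exp (- t))). generalize dependent (g0 (exp (- t))). intros.
  assert (0 <= INR n ^ 3) by (apply pow_le; lra).
  repeat apply Rplus_le_le_0_compat; try (repeat apply Rmult_le_pos); lra.
Qed.

(** * Modulus and phase of the product *)

(* [L] lists each part [1, ..., N] two or three times. *)
Definition two_or_three (L : list nat) (N : nat) : Prop :=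
  all_pos L /\ forall h, (forall j, (1 <= j)%nat -> 0 <= h j) ->
    2 * sumL (seq 1 N) h <= sumL L h <= 3 * sumL (seq 1 N) h.

(** This is [- d/ds ln F (exp (- s))], and also the derivative of [phase L s] at 0; the saddle point
    equation is [mean L s = n]. *)
Definition mean (L : list nat) (s : R) : R := sumL L (fun j => INR j * g0 (rho s j)).

Lemma sumL_minus (L : list nat) (h h' : nat -> R) :
  sumL L (fun j => h j - h' j) = sumL L h - sumL L h'.
Proof. induction L as [|j L IH]; simpl; [ring|]. rewrite IH. ring. Qed.

Lemma sumL_all_pos_le (L : list nat) (h h' : nat -> R) : all_pos L ->
  (forall j, (1 <= j)%nat -> h j <= h' j) -> sumL L h <= sumL L h'.
Proof.
intros hL H. apply sumL_le. intros j hj. apply H.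
unfold all_pos in hL. rewrite List.Forall_forall in hL. apply hL, hj.
Qed.

Lemma rho_nonneg_g (s : R) (j : nat) : 0 < s -> (1 <= j)%nat ->
  0 < INR j /\ 0 < g0 (rho s j) /\ 0 < g1 (rho s j) /\ 0 < g2 (rho s j).
Proof.
intros hs hj. destruct (g_pos _ (rho_bounds s j hs hj)) as [? [? [? _]]].
splits; try assumption. apply lt_0_INR. lia.
Qed.

Lemma mean_le (L : list nat) (N : nat) (s : R) : two_or_three L N -> 0 < s ->
  mean L s <= 400 / 81 / s ^ 2.
Proof.
intros [hL hb] hs. unfold mean.
destruct (hb (fun j => INR j * g0 (rho s j))) as [_ H].
{ intros j hj. destruct (rho_nonneg_g s j hs hj) as [? [? _]]. nra. }
assert (Z := sum_g0_le N s hs).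
replace (400 / 81 / s ^ 2) with (3 * (400 / 243 / s ^ 2)) by (field; lra). lra.
Qed.

(** Summation of [arg1_bounds]: the constant is [3 * 400/243 * 612/100 / 6]. *)
Lemma phase_bound (L : list nat) (N : nat) (s th : R) : two_or_three L N -> 0 < s -> 0 <= th ->
  Rabs (phase L s th - mean L s * th) <= 102 / 100 * (400 / 81) * th ^ 3 / s ^ 4.
Proof.
intros [hL hb] hs hth.
assert (E : mean L s * th - phase L s th =
  sumL L (fun j => g0 (rho s j) * (INR j * th) - arg1 (rho s j) (INR j * th))).
{ rewrite sumL_minus. unfold mean, phase. f_equal. rewrite Rmult_comm, <- sumL_scal.
  apply sumL_ext. intros; ring. }
assert (Lo : 0 <= mean L s * th - phase L s th).
{ rewrite E, <- (sumL_0 L). apply sumL_all_pos_le; [exact hL|]. intros j hj.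
  assert (hj0 := pos_INR j).
  apply (arg1_bounds (rho s j) (INR j * th)); [apply rho_bounds; assumption|nra]. }
assert (Up : mean L s * th - phase L s th <= 102 / 100 * (400 / 81) * th ^ 3 / s ^ 4).
{ rewrite E.
  apply Rle_trans with (sumL L (fun j => th ^ 3 / 6 * (INR j ^ 3 * g2 (rho s j)))).
  - apply sumL_all_pos_le; [exact hL|]. intros j hj. assert (hj0 := pos_INR j).
    destruct (arg1_bounds (rho s j) (INR j * th)) as [_ H]; [apply rho_bounds; assumption|nra|].
    replace (th ^ 3 / 6 * (INR j ^ 3 * g2 (rho s j))) with
      (rho s j * (1 + rho s j) / (1 - rho s j) ^ 3 * (INR j * th) ^ 3 / 6); [exact H|].
    assert (hr := rho_bounds s j hs hj). unfold g2. field. lra.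
  - rewrite sumL_scal.
    destruct (hb (fun j => INR j ^ 3 * g2 (rho s j))) as [_ H].
    { intros j hj. destruct (rho_nonneg_g s j hs hj) as [? [_ [_ ?]]].
      apply Rmult_le_pos; [apply pow_le|]; lra. }
    assert (Z := sum_g2_le N s hs).
    replace (102 / 100 * (400 / 81) * th ^ 3 / s ^ 4) with
      (th ^ 3 / 6 * (3 * (400 / 243 * (612 / 100) / s ^ 4))) by (field; lra).
    apply Rmult_le_compat_l; [|lra]. assert (0 <= th ^ 3) by (apply pow_le; lra). lra. }
apply Rabs_le. lra.
Qed.

Lemma lnG_diff (L : list nat) (s th : R) :
  lnG L s 0 - lnG L s th = sumL L (fun j => lnmod (rho s j) (INR j * th) - lnmod (rho s j) 0).
Proof.
rewrite sumL_minus. unfold lnG.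
rewrite (sumL_ext L (fun j => lnmod (rho s j) (INR j * 0)) (fun j => lnmod (rho s j) 0));
  [ring|]. intros; rewrite Rmult_0_r; reflexivity.
Qed.

Lemma lnG_ge (L : list nat) (N : nat) (s th : R) : two_or_three L N -> 0 < s ->
  - (400 / 81 * th ^ 2 / s ^ 3) <= lnG L s th - lnG L s 0.
Proof.
intros [hL hb] hs.
cut (lnG L s 0 - lnG L s th <= 400 / 81 * th ^ 2 / s ^ 3); [lra|]. rewrite lnG_diff.
apply Rle_trans with (sumL L (fun j => th ^ 2 / 2 * (INR j ^ 2 * g1 (rho s j)))).
- apply sumL_all_pos_le; [exact hL|]. intros j hj. assert (hr := rho_bounds s j hs hj).
  assert (H := lnmod_diff_le (rho s j) (INR j * th) hr).
  replace (th ^ 2 / 2 * (INR j ^ 2 * g1 (rho s j))) with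
    (rho s j / (1 - rho s j) ^ 2 * (INR j * th) ^ 2 / 2); [exact H|].
  unfold g1. field. lra.
- rewrite sumL_scal.
  destruct (hb (fun j => INR j ^ 2 * g1 (rho s j))) as [_ H].
  { intros j hj. destruct (rho_nonneg_g s j hs hj) as [? [_ [? _]]].
    apply Rmult_le_pos; [apply pow_le|]; lra. }
  assert (Z := sum_g1_le N s hs).
  replace (400 / 81 * th ^ 2 / s ^ 3) with (th ^ 2 / 2 * (3 * (800 / 243 / s ^ 3))) by (field; lra).
  apply Rmult_le_compat_l; [|lra]. assert (H' := pow2_ge_0 th). lra.
Qed.

(** The full series of [exp (- j t) (1 - cos (j y))] over [j >= 1], in closed form. *)
Definition Bsum (t y : R) : R := exp (- t) * cosdef (exp (- t)) y.

(** With [X = 2 (1 - cos y)], [Bsum] is [coth (t / 2) / 2] times [X / (kap t + X)], which increases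
    with [X] and decreases with [kap t]. *)
Lemma Bsum_ge (t y c Y : R) : 0 < t -> kap t <= c -> 0 < Y <= 2 * (1 - cos y) ->
  / t * (Y / (c + Y)) <= Bsum t y.
Proof.
intros ht hk hY. assert (hr := exp_neg_lt1 t ht). destruct (kap_pos t ht) as [_ P].
assert (E : Bsum t y = (1 + exp (- t)) / (1 - exp (- t)) * ((1 - cos y) / (kap t + 2 * (1 - cos y)))).
{ unfold Bsum, cosdef. rewrite modsq_cos, sq_one_sub_exp.
  assert (0 < exp (- t) * kap t) by nra. assert (0 <= exp (- t) * (1 - cos y)) by nra.
  field. splits; try lra. }
rewrite E. apply Rle_trans with (2 / t * ((1 - cos y) / (kap t + 2 * (1 - cos y)))).
- replace (2 / t * ((1 - cos y) / (kap t + 2 * (1 - cos y)))) with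
    (/ t * (2 * (1 - cos y) / (kap t + 2 * (1 - cos y)))) by (field; lra).
  apply Rmult_le_compat_l; [left; apply Rinv_0_lt_compat; lra|].
  set (X := 2 * (1 - cos y)) in *. clearbody X.
  apply Rmult_le_reg_r with ((c + Y) * (kap t + X)); [nra|].
  replace (Y / (c + Y) * ((c + Y) * (kap t + X))) with (Y * (kap t + X)) by (field; lra).
  replace (X / (kap t + X) * ((c + Y) * (kap t + X))) with (X * (c + Y)) by (field; lra).
  nra.
- apply Rmult_le_compat_r; [|apply coth_ge, ht]. apply Rdiv_le_0_compat; lra.
Qed.

(** The price of dropping the parts above [N]: the tail is at most [2 r^(N+1) / (1 - r)], where
    [r^N <= 1 / (N t)] and [r / (1 - r) <= 1 / t]. *)
Lemma Bsum_trunc (t y : R) (N : nat) : 0 < t -> (1 <= N)%nat ->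
  Bsum t y - 2 / (INR N * t ^ 2) <= sumL (seq 1 N) (fun j => exp (- t) ^ j * (1 - cos (INR j * y))).
Proof.
intros ht hN. assert (hr := exp_neg_lt1 t ht). set (r := exp (- t)) in *.
assert (hN0 : 0 < INR N) by (apply lt_0_INR; lia).
rewrite (sumL_ext _ _ (fun j => r * (r ^ (j - 1) * (1 - cos (INR j * y))))).
2: { intros j hj. apply in_seq in hj. replace j with (S (j - 1)) at 1 by lia. simpl. ring. }
rewrite sumL_scal, geom_cos_sum by exact hr.
destruct (cosrem_bounds r y N hr) as [_ H]. unfold Bsum. fold r.
assert (HN : 0 < r ^ N) by (apply pow_lt; lra).
assert (r * (r ^ N * cosrem r y N) <= 2 / (INR N * t ^ 2)); [|lra].
apply Rle_trans with (r * (r ^ N * (2 / (1 - r)))).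
{ apply Rmult_le_compat_l; [lra|]. apply Rmult_le_compat_l; lra. }
assert (Q : r ^ N * (INR N * t) <= 1).
{ assert (Z := rho_pow t 1 N). unfold rho in Z. simpl INR in Z. rewrite !Rmult_1_l in Z.
  fold r in Z. rewrite Z. assert (Y := exp_neg_inv (INR N * t)).
  generalize (exp_ineq1_le (INR N * t)) (exp_pos (- (INR N * t))). nra. }
assert (W : r * t <= 1 - r).
{ assert (Y := exp_neg_inv t). fold r in Y. generalize (exp_ineq1_le t). nra. }
apply Rmult_le_reg_r with (INR N * t ^ 2 * (1 - r)).
{ apply Rmult_lt_0_compat; [|lra]. apply Rmult_lt_0_compat; [lra|apply pow_lt; lra]. }
replace (r * (r ^ N * (2 / (1 - r))) * (INR N * t ^ 2 * (1 - r))) with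
  (2 * ((r ^ N * (INR N * t)) * (r * t))) by (field; lra).
replace (2 / (INR N * t ^ 2) * (INR N * t ^ 2 * (1 - r))) with (2 * (1 * (1 - r))) by (field; lra).
apply Rmult_le_compat_l; [lra|]. apply Rmult_le_compat; try lra.
- apply Rmult_le_pos; [lra|]. nra.
- nra.
Qed.

(** Only the powers [rho_j ^ k] with [k <= K] are kept, all terms being nonnegative; summing over
    [j] first produces [Bsum] at [(k s, k th)]. *)
Lemma lnG_le (L : list nat) (N K : nat) (s th : R) : two_or_three L N -> 0 < s -> (1 <= N)%nat ->
  lnG L s th - lnG L s 0 <=
  - (2 * sumL (seq 1 K) (fun k => (Bsum (INR k * s) (INR k * th) - 2 / (INR N * (INR k * s) ^ 2)) / INR k)).
Proof.
intros [hL hb] hs hN.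
cut (2 * sumL (seq 1 K) (fun k => (Bsum (INR k * s) (INR k * th) - 2 / (INR N * (INR k * s) ^ 2)) / INR k)
   <= lnG L s 0 - lnG L s th); [lra|].
rewrite lnG_diff.
apply Rle_trans with (sumL L (fun j => sumL (seq 1 K) (fun k => rho s j ^ k * (1 - cos (INR k * (INR j * th))) / INR k))).
2: { apply sumL_all_pos_le; [exact hL|]. intros j hj. apply lnmod_diff_ge, rho_bounds; assumption. }
rewrite sumL_exchange, <- sumL_scal. apply sumL_le. intros k hk. apply in_seq in hk.
assert (hk0 : 0 < INR k) by (apply lt_0_INR; lia).
destruct (hb (fun j => rho s j ^ k * (1 - cos (INR k * (INR j * th))) / INR k)) as [H _].
{ intros j hj. assert (hr := rho_bounds s j hs hj). assert (hc := COS_bound (INR k * (INR j * th))).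
  apply Rdiv_le_0_compat; [|lra]. apply Rmult_le_pos; [apply pow_le; lra|lra]. }
apply Rle_trans with (2 := H). apply Rmult_le_compat_l; [lra|].
rewrite (sumL_ext _ _ (fun j => / INR k * (exp (- (INR k * s)) ^ j * (1 - cos (INR j * (INR k * th)))))).
- rewrite sumL_scal. unfold Rdiv at 1. rewrite Rmult_comm.
  apply Rmult_le_compat_l; [left; apply Rinv_0_lt_compat; lra|].
  apply Bsum_trunc; [nra|exact hN].
- intros j _. replace (exp (- (INR k * s))) with (rho s k) by reflexivity. rewrite !rho_pow.
  replace (INR k * (INR j * th)) with (INR j * (INR k * th)) by ring.
  replace (INR k * (INR j * s)) with (INR j * (INR k * s)) by ring. field. lra.
Qed.

(** The ranges are those of [k s] and [k th] for [k <= 5], [s <= 1/18], [th <= 3 s / 2]. There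
    [1 - y^2 / 12 >= 0.9855] and [1 + t^2 / 11 <= 1.00702], and the quotient of these numbers is
    below 1.022. *)
Lemma Bsum_small (t y : R) : 0 < t <= 5 / 18 -> 0 < y <= 5 / 12 ->
  / t * (y ^ 2 / (y ^ 2 + 1022 / 1000 * t ^ 2)) <= Bsum t y.
Proof.
intros ht hy.
assert (hy2 : 0 < y ^ 2) by (apply pow_lt; lra). assert (ht2 : 0 < t ^ 2) by (apply pow_lt; lra).
assert (ht2' : t ^ 2 <= 25 / 324) by nra. assert (hy2' : y ^ 2 <= 25 / 144) by nra.
assert (hk := kap_le t ltac:(lra)). assert (hc := one_sub_cos_ge y ltac:(lra)).
replace (y ^ 4) with (y ^ 2 * y ^ 2) in hc by ring.
apply Rle_trans with (/ t * (9855 / 10000 * y ^ 2 / (100702 / 100000 * t ^ 2 + 9855 / 10000 * y ^ 2))).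
- apply Rmult_le_compat_l; [left; apply Rinv_0_lt_compat; lra|].
  set (u := y ^ 2) in *. set (v := t ^ 2) in *. clearbody u v.
  apply Rmult_le_reg_r with ((u + 1022 / 1000 * v) * (100702 / 100000 * v + 9855 / 10000 * u)); [nra|].
  replace (u / (u + 1022 / 1000 * v) * ((u + 1022 / 1000 * v) * (100702 / 100000 * v + 9855 / 10000 * u)))
    with (u * (100702 / 100000 * v + 9855 / 10000 * u)) by (field; lra).
  replace (9855 / 10000 * u / (100702 / 100000 * v + 9855 / 10000 * u) * ((u + 1022 / 1000 * v) * (100702 / 100000 * v + 9855 / 10000 * u)))
    with (u * (9855 / 10000 * (u + 1022 / 1000 * v))) by (field; lra).
  apply Rmult_le_compat_l; lra.
- apply Bsum_ge; [lra| |].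
  + apply Rle_trans with (1 := hk). nra.
  + split; [lra|]. nra.
Qed.

(** The bound of [Bsum_small] is homogeneous, so the power [k] contributes the same quotient over
    [s k^2]; 5269/1800 is twice the sum of [1 / k^2] for [k <= 5]. The summand 1/100 covers the
    truncation at [N]. *)
Lemma lnG_le_near (L : list nat) (N : nat) (s th : R) : two_or_three L N ->
  0 < s <= 1 / 18 -> 1000 <= INR N * s ^ 2 -> 0 < th <= 3 / 2 * s ->
  lnG L s th - lnG L s 0 <=
    1 / 100 - 5269 / 1800 / s * (th ^ 2 / (th ^ 2 + 1022 / 1000 * s ^ 2)).
Proof.
intros hL hs hN hth.
assert (hs2 : 0 < s ^ 2) by (apply pow_lt; lra).
assert (hN1 : (1 <= N)%nat).
{ destruct N as [|N]; [simpl in hN; lra|lia]. }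
assert (hN0 : 0 < INR N) by (apply lt_0_INR; lia).
apply Rle_trans with (1 := lnG_le L N 5 s th hL (proj1 hs) hN1).
set (q := th ^ 2 / (th ^ 2 + 1022 / 1000 * s ^ 2)).
assert (T : forall k, In k (seq 1 5) ->
  q / s * (1 / INR k ^ 2) - 2 / (INR N * s ^ 2) * (1 / INR k ^ 3) <=
  (Bsum (INR k * s) (INR k * th) - 2 / (INR N * (INR k * s) ^ 2)) / INR k).
{ intros k hk. apply in_seq in hk.
  assert (hk1 : 1 <= INR k) by (apply (le_INR 1); lia).
  assert (hk5 : INR k <= 5) by (replace 5 with (INR 5) by (simpl; lra); apply le_INR; lia).
  assert (B := Bsum_small (INR k * s) (INR k * th) ltac:(nra) ltac:(nra)).
  replace (q / s * (1 / INR k ^ 2) - 2 / (INR N * s ^ 2) * (1 / INR k ^ 3)) with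
    ((/ (INR k * s) * ((INR k * th) ^ 2 / ((INR k * th) ^ 2 + 1022 / 1000 * (INR k * s) ^ 2))
      - 2 / (INR N * (INR k * s) ^ 2)) / INR k).
  - apply Rmult_le_compat_r; [left; apply Rinv_0_lt_compat; lra|]. lra.
  - unfold q. field. splits; try nra. }
assert (S := sumL_le _ _ _ T). rewrite sumL_minus, !sumL_scal in S.
assert (Z1 : sumL (seq 1 5) (fun k => 1 / INR k ^ 2) = 5269 / 3600) by (simpl; field).
assert (Z2 : sumL (seq 1 5) (fun k => 1 / INR k ^ 3) <= 119 / 100) by (simpl; lra).
rewrite Z1 in S.
assert (P : 0 < 2 / (INR N * s ^ 2) <= 2 / 1000).
{ split; [apply Rdiv_lt_0_compat; nra|]. apply Rmult_le_compat_l; [lra|]. apply Rinv_le_contravar; lra. }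
replace (5269 / 1800 / s * q) with (2 * (q / s * (5269 / 3600))) by (field; lra).
assert (2 / (INR N * s ^ 2) * sumL (seq 1 5) (fun k => 1 / INR k ^ 3) <= 2 / 1000 * (119 / 100)).
{ apply Rmult_le_compat; try lra. apply sumL_nonneg. intros j hj. apply in_seq in hj.
  apply Rdiv_le_0_compat; [lra|]. apply pow_lt, lt_0_INR. lia. }
lra.
Qed.

(** For [k >= 2] the angle [k th] may come close to a multiple of [2 PI], where [Bsum] vanishes, so
    only [k = 1] is kept. Monotonicity of the cosine reduces to [th = 3 s / 2], and
    [2 * 22480 / 32483 > 1.35]. *)
Lemma lnG_le_far (L : list nat) (N : nat) (s th : R) : two_or_three L N ->
  0 < s <= 1 / 18 -> 1000 <= INR N * s ^ 2 -> 3 / 2 * s <= th <= PI ->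
  lnG L s th - lnG L s 0 <= 1 / 100 - 135 / 100 / s.
Proof.
intros hL hs hN hth.
assert (hs2 : 0 < s ^ 2) by (apply pow_lt; lra). assert (hs2' : s ^ 2 <= 1 / 324) by nra.
assert (hN1 : (1 <= N)%nat).
{ destruct N as [|N]; [simpl in hN; lra|lia]. }
assert (hN0 : 0 < INR N) by (apply lt_0_INR; lia).
apply Rle_trans with (1 := lnG_le L N 1 s th hL (proj1 hs) hN1).
simpl sumL. replace (INR 1) with 1 by reflexivity. rewrite !Rmult_1_l.
assert (hc : 1 - cos (3 / 2 * s) <= 1 - cos th).
{ assert (cos th <= cos (3 / 2 * s)); [|lra]. assert (X := PI_RGT_0).
  destruct (Req_dec (3 / 2 * s) th) as [->|]; [lra|]. apply cos_decr_1; lra. }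
assert (hc' := one_sub_cos_ge (3 / 2 * s) ltac:(lra)).
assert (hk := kap_le s ltac:(lra)).
assert (B : / s * (2248 / 1000 * s ^ 2 / (10003 / 10000 * s ^ 2 + 2248 / 1000 * s ^ 2)) <= Bsum s th).
{ apply Bsum_ge; [lra| |].
  - apply Rle_trans with (1 := hk). nra.
  - split; [lra|]. replace ((3 / 2 * s) ^ 4) with (81 / 16 * (s ^ 2 * s ^ 2)) in hc' by field.
    replace ((3 / 2 * s) ^ 2) with (9 / 4 * s ^ 2) in hc' by field. nra. }
replace (/ s * (2248 / 1000 * s ^ 2 / (10003 / 10000 * s ^ 2 + 2248 / 1000 * s ^ 2))) with
  (/ s * (22480 / 32483)) in B by (field; lra).
assert (P : 2 / (INR N * s ^ 2) <= 2 / 1000).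
{ apply Rmult_le_compat_l; [lra|]. apply Rinv_le_contravar; lra. }
assert (0 < / s) by (apply Rinv_0_lt_compat; lra).
replace (135 / 100 / s) with (135 / 100 * / s) by (field; lra).
replace (s * (s * 1)) with (s ^ 2) by ring. lra.
Qed.

(** * The integral over the circle *)

Lemma RInt_ge_primitive (f F dF : R -> R) (a b : R) : a <= b -> ex_RInt f a b ->
  (forall x, is_derive F x (dF x)) -> (forall x, ex_derive dF x) ->
  (forall x, a < x < b -> dF x <= f x) -> F b - F a <= RInt f a b.
Proof.
intros hab hf hF hdF H.
assert (I : is_RInt dF a b (minus (F b) (F a))).
{ apply (is_RInt_derive F dF).
  - intros x _. apply hF.
  - intros x _. apply (ex_derive_continuous dF x), hdF. }
change (F b - F a) with (minus (F b) (F a)). rewrite <- (is_RInt_unique _ _ _ _ I).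
apply RInt_le; try assumption. exists (minus (F b) (F a)). exact I.
Qed.

Lemma exp_mul_nat (n : nat) (x : R) : exp (INR n * x) = exp x ^ n.
Proof.
induction n as [|n IH]; [simpl; rewrite Rmult_0_l; apply exp_0|].
rewrite S_INR. simpl pow. rewrite <- IH, <- exp_plus. f_equal. ring.
Qed.

Lemma exp_ge_cubic (x : R) : 0 <= x -> 1 + x + x ^ 2 / 2 + x ^ 3 / 6 <= exp x.
Proof.
assert (H1 : forall t, 0 <= t -> 0 <= exp t - 1 - t).
{ intros t _. generalize (exp_ineq1_le t). lra. }
assert (H2 : forall t, 0 <= t -> 0 <= exp t - 1 - t - t ^ 2 / 2).
{ apply (nonneg_of_derive _ (fun t => exp t - 1 - t)); [derive_tac|exact H1|]. rewrite exp_0. lra. }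
assert (H3 : forall t, 0 <= t -> 0 <= exp t - 1 - t - t ^ 2 / 2 - t ^ 3 / 6).
{ apply (nonneg_of_derive _ (fun t => exp t - 1 - t - t ^ 2 / 2)); [derive_tac|exact H2|]. rewrite exp_0. lra. }
intros h. generalize (H3 x h). lra.
Qed.

(** Certifies numerical values of the exponential: [q] is a short decimal below the cubic Taylor
    polynomial at [x], so that only a power of a rational has to be evaluated. *)
Lemma exp_neg_le (n : nat) (x q e : R) : 0 <= x -> 0 < e ->
  0 <= q <= 1 + x + x ^ 2 / 2 + x ^ 3 / 6 -> 1 <= e * q ^ n -> exp (- (INR n * x)) <= e.
Proof.
intros hx he hq H. assert (E := exp_neg_inv (INR n * x)). assert (P := exp_pos (- (INR n * x))).
rewrite exp_mul_nat in E.
assert (Q : q ^ n <= exp x ^ n).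
{ apply pow_incr. split; [lra|]. apply Rle_trans with (1 := proj2 hq). apply exp_ge_cubic, hx. }
apply Rmult_le_reg_l with (exp x ^ n); [apply pow_lt, exp_pos|]. rewrite E.
apply Rle_trans with (1 := H). rewrite (Rmult_comm e). apply Rmult_le_compat_r; lra.
Qed.

(** [exp (- c / s) / s^m] increases for [s <= c / m], so its value at [s = 1/18] is a bound. The
    powers [m = 2] and [m = 5] used later turn exponentially small tails into multiples of
    [w^10]. *)
Lemma exp_neg_div_le (m : nat) (c s : R) : (1 <= m)%nat -> 0 < s <= 1 / 18 -> INR m <= 18 * c ->
  exp (- (c / s)) <= exp (- (18 * c)) * (18 * s) ^ m.
Proof.
intros hm hs hc. assert (hm0 : 0 < INR m) by (apply lt_0_INR; lia).
assert (hz : 18 <= / s).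
{ replace 18 with (/ (1 / 18)) by field. apply Rinv_le_contravar; lra. }
set (z := / s) in *.
set (y := c * (z - 18) / INR m).
assert (hy : z / 18 <= exp y).
{ apply Rle_trans with (1 + y); [|apply exp_ineq1_le].
  assert ((z - 18) / 18 <= y); [|lra]. unfold y.
  apply Rmult_le_reg_r with (18 * INR m); [lra|].
  replace ((z - 18) / 18 * (18 * INR m)) with ((z - 18) * INR m) by field.
  replace (c * (z - 18) / INR m * (18 * INR m)) with ((z - 18) * (18 * c)) by (field; lra).
  apply Rmult_le_compat_l; lra. }
assert (E : exp (- (c / s)) = exp (- (18 * c)) * exp (- (INR m * y))).
{ rewrite <- exp_plus. f_equal. unfold y, z. field. lra. }
rewrite E. apply Rmult_le_compat_l; [left; apply exp_pos|].
assert (X := exp_neg_inv (INR m * y)). rewrite exp_mul_nat in X.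
apply Rmult_le_reg_l with (exp y ^ m); [apply pow_lt, exp_pos|]. rewrite X.
rewrite <- Rpow_mult_distr. rewrite <- (pow1 m) at 1. apply pow_incr. split; [lra|].
replace 1 with (z / 18 * (18 * s)) by (unfold z; field; lra).
apply Rmult_le_compat_r; lra.
Qed.

(* On the main interval, with [v = th / (0.9 w^3)], the three factors of the integrand
   are bounded below by [exp (- 4 v^2) >= (1 - v^2)^4], [1 - psi^2 / 2] and
   [0.999 * th^2 / 2]. *)
Definition Qmain (v : R) : R :=
  v ^ 3 / 3 - 4 * v ^ 5 / 5 + 6 * v ^ 7 / 7 - 4 * v ^ 9 / 9 + v ^ 11 / 11
  - 705 / 1000 * (531441 / 1000000) *
    (v ^ 9 / 9 - 4 * v ^ 11 / 11 + 6 * v ^ 13 / 13 - 4 * v ^ 15 / 15 + v ^ 17 / 17).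

Definition dQmain (v : R) : R :=
  v ^ 2 * (1 - v ^ 2) ^ 4 * (1 - 705 / 1000 * (9 / 10 * v) ^ 6).

Lemma is_derive_Qmain (v : R) : is_derive Qmain v (dQmain v).
Proof. unfold Qmain, dQmain. auto_derive; [exact I|]. field. Qed.

(* Here [w = sqrt s], so [w ^ 3] is the order of the width of the Gaussian peak. *)
Section Integral.

(** [G th] stands for [lnG L s th - lnG L s 0] and [psi th] for [phase L s th - n th]; normalising
    [G] at 0 makes all bounds absolute. *)
Variables (G psi : R -> R) (w : R).
Hypothesis hw : 0 < w.
Hypothesis hw18 : 18 * w ^ 2 <= 1.
Hypothesis dG : forall x, ex_derive G x.
Hypothesis dpsi : forall x, ex_derive psi x.
Hypothesis G_ge : forall th, 0 <= th -> - (400 / 81 * th ^ 2 / w ^ 6) <= G th.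
Hypothesis psi_le : forall th, 0 <= th ->
  Rabs (psi th) <= 102 / 100 * (400 / 81) * th ^ 3 / w ^ 8.
Hypothesis G_near : forall th, 0 < th <= 3 / 2 * w ^ 2 ->
  G th <= 1 / 100 - 5269 / 1800 / w ^ 2 * (th ^ 2 / (th ^ 2 + 1022 / 1000 * w ^ 4)).
Hypothesis G_far : forall th, 3 / 2 * w ^ 2 <= th <= PI -> G th <= 1 / 100 - 135 / 100 / w ^ 2.

Let f (th : R) : R := exp (G th) * cos (psi th) * (1 - cos th).

Lemma f_int (a b : R) : ex_RInt f a b.
Proof.
apply ex_RInt_ex_derive. intros x. unfold f. auto_derive. splits; [apply dG|apply dpsi].
Qed.

Lemma w_le : w <= 23571 / 100000.
Proof. destruct (Rle_dec w (23571 / 100000)); [assumption|nra]. Qed.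

Lemma exp_100_le : exp (1 / 100) <= 10102 / 10000.
Proof. apply Rle_trans with (1 := exp_le_inv_one_sub (1 / 100) ltac:(lra)). lra. Qed.

(** The factor 108/100 is nearly the largest for which the cubic bound on the phase stays below
    [3/2 < PI/2]. *)
Lemma psi_small (th : R) : 0 <= th <= 108 / 100 * w ^ 3 -> Rabs (psi th) <= 3 / 2.
Proof.
intros h. assert (hw3 : 0 < w ^ 3) by (apply pow_lt; lra). assert (hw' := w_le).
apply Rle_trans with (1 := psi_le th (proj1 h)).
assert (H3 : th ^ 3 <= (108 / 100 * w ^ 3) ^ 3) by (apply pow_incr; lra).
assert (hw8 : 0 < w ^ 8) by (apply pow_lt; lra).
apply Rmult_le_reg_r with (w ^ 8); [exact hw8|].
replace (102 / 100 * (400 / 81) * th ^ 3 / w ^ 8 * w ^ 8) with (102 / 100 * (400 / 81) * th ^ 3) by (field; lra).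
replace ((108 / 100 * w ^ 3) ^ 3) with (1259712 / 1000000 * (w * w ^ 8)) in H3 by field.
assert (w * w ^ 8 <= 23571 / 100000 * w ^ 8) by (apply Rmult_le_compat_r; lra). lra.
Qed.

Lemma f_lower_bound (th h : R) : 0 <= th -> exp (G th) <= h -> - (th ^ 2 / 2 * h) <= f th.
Proof.
intros hth hE. unfold f. assert (P := exp_pos (G th)). assert (C := COS_bound (psi th)).
assert (D := one_sub_cos_le th). assert (D' := COS_bound th).
assert (A1 : 0 <= (1 - cos th) * exp (G th) <= th ^ 2 / 2 * h).
{ split; [apply Rmult_le_pos; lra|]. apply Rmult_le_compat; lra. }
replace (exp (G th) * cos (psi th) * (1 - cos th)) with ((1 - cos th) * exp (G th) * cos (psi th)) by ring.
nra.
Qed.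

Lemma piece_main : 1329 / 100000 * w ^ 9 <= RInt f 0 (9 / 10 * w ^ 3).
Proof.
assert (hw3 : 0 < w ^ 3) by (apply pow_lt; lra). assert (hw' := w_le).
(* This width turns [400/81 * th^2 / w^6] into exactly [4 v^2], which leads to a polynomial minorant
   with an explicit primitive. *)
set (d := 9 / 10 * w ^ 3). assert (hd : 0 < d) by (unfold d; lra).
assert (H := RInt_ge_primitive f (fun th => 999 / 2000 * d ^ 3 * Qmain (th / d))
  (fun th => 999 / 2000 * d ^ 2 * dQmain (th / d)) 0 d (Rlt_le _ _ hd) (f_int 0 d)).
eapply Rle_trans; [clear H|apply H; clear H].
- replace (0 / d) with 0 by (field; lra). replace (d / d) with 1 by (field; lra).
  unfold Qmain. unfold d.
  replace ((9 / 10 * w ^ 3) ^ 3) with (729 / 1000 * w ^ 9) by field.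
  assert (0 < w ^ 9) by (apply pow_lt; lra). simpl (0 ^ _). lra.
- intros x. replace (999 / 2000 * d ^ 2 * dQmain (x / d)) with
    (999 / 2000 * d ^ 3 * (/ d * dQmain (x / d))) by (field; lra).
  apply (is_derive_scal (fun th => Qmain (th / d)) x (999 / 2000 * d ^ 3)).
  apply (is_derive_comp Qmain (fun th => th / d)); [apply is_derive_Qmain|].
  auto_derive; [lra|]. field. lra.
- intros x. unfold dQmain. auto_derive. lra.
- intros th hth. unfold f.
  set (v := th / d). assert (hv : 0 < v < 1).
  { unfold v. split; [apply Rdiv_lt_0_compat; lra|]. apply Rmult_lt_reg_r with d; [lra|].
    replace (th / d * d) with th by (field; lra). lra. }
  assert (Eth : th = 9 / 10 * v * w ^ 3) by (unfold v, d; field; lra).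
  assert (hv2 : 0 <= 1 - v ^ 2 <= 1) by nra.
  assert (X1 : (1 - v ^ 2) ^ 4 <= exp (G th)).
  { assert (hG := G_ge th ltac:(lra)).
    replace (- (400 / 81 * th ^ 2 / w ^ 6)) with (INR 4 * - v ^ 2) in hG
      by (rewrite Eth; simpl; field; lra).
    apply Rle_trans with (exp (INR 4 * - v ^ 2)).
    - rewrite exp_mul_nat. apply pow_incr. split; [lra|]. generalize (exp_ineq1_le (- v ^ 2)). lra.
    - destruct (Req_dec (INR 4 * - v ^ 2) (G th)) as [->|]; [lra|]. apply Rlt_le, exp_increasing. lra. }
  assert (X2 : 0 <= 1 - 705 / 1000 * (9 / 10 * v) ^ 6 <= cos (psi th)).
  { assert (v6 : 0 <= v ^ 6 <= 1).
    { split; [apply pow_le; lra|]. rewrite <- (pow1 6). apply pow_incr. lra. }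
    split; [replace ((9 / 10 * v) ^ 6) with (531441 / 1000000 * v ^ 6) by field; lra|].
    assert (C := one_sub_cos_le (psi th)).
    assert (psi th ^ 2 / 2 <= 705 / 1000 * (9 / 10 * v) ^ 6); [|lra].
    assert (S := psi_le th ltac:(lra)).
    assert (S2 : psi th ^ 2 <= (102 / 100 * (400 / 81) * th ^ 3 / w ^ 8) ^ 2).
    { rewrite <- (pow2_abs (psi th)). apply pow_incr. split; [apply Rabs_pos|exact S]. }
    replace ((102 / 100 * (400 / 81) * th ^ 3 / w ^ 8) ^ 2) with
      ((102 / 100 * (400 / 81)) ^ 2 * w ^ 2 * (9 / 10 * v) ^ 6) in S2 by (rewrite Eth; field; lra).
    assert (0 <= (9 / 10 * v) ^ 6) by (apply pow_le; lra).
    (* Here [w^2 <= 1/18] enters; half of 141/100 is the 705/1000 of [Qmain]. *)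
    assert ((102 / 100 * (400 / 81)) ^ 2 * w ^ 2 * (9 / 10 * v) ^ 6 <= 141 / 100 * (9 / 10 * v) ^ 6)
      by (apply Rmult_le_compat_r; lra).
    lra. }
  assert (X3 : 999 / 1000 * (th ^ 2 / 2) <= 1 - cos th).
  { assert (C := one_sub_cos_ge th ltac:(lra)).
    assert (th <= 1 / 10). { assert (w ^ 3 <= 1 / 10) by nra. unfold d in hth. lra. }
    replace (th ^ 4) with (th ^ 2 * th ^ 2) in C by ring. assert (0 <= th ^ 2) by nra.
    assert (th ^ 2 <= 1 / 100) by nra. nra. }
  replace (999 / 2000 * d ^ 2 * dQmain v) with
    ((1 - v ^ 2) ^ 4 * (1 - 705 / 1000 * (9 / 10 * v) ^ 6) * (999 / 1000 * (th ^ 2 / 2))).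
  + assert (0 <= (1 - v ^ 2) ^ 4) by (apply pow_le; lra).
    apply Rmult_le_compat; try assumption.
    * apply Rmult_le_pos; lra.
    * assert (0 <= th ^ 2) by nra. lra.
    * apply Rmult_le_compat; lra.
  + unfold dQmain. replace th with (v * d) by (unfold v; field; lra). field.
Qed.

(** Beyond [v = 1] the minorant [(1 - v^2)^4] is no longer valid, but the cosine is still
    nonnegative; this stretch is simply discarded. *)
Lemma piece_pos : 0 <= RInt f (9 / 10 * w ^ 3) (108 / 100 * w ^ 3).
Proof.
assert (hw3 : 0 < w ^ 3) by (apply pow_lt; lra).
apply RInt_ge_0; [lra|apply f_int|]. intros x hx. unfold f.
assert (P := psi_small x ltac:(lra)). apply Rabs_le_between in P. assert (Q := PI2_3_2).
apply Rmult_le_pos.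
- apply Rmult_le_pos; [left; apply exp_pos|]. apply cos_ge_0; lra.
- generalize (COS_bound x). lra.
Qed.

Lemma piece_gauss : - (1002 / 100000 * w ^ 9) <= RInt f (108 / 100 * w ^ 3) (w ^ 2 / 2).
Proof.
assert (hw3 : 0 < w ^ 3) by (apply pow_lt; lra). assert (hw2 : 0 < w ^ 2) by (apply pow_lt; lra).
assert (hw' := w_le). assert (hw6 : 0 < w ^ 6) by (apply pow_lt; lra).
assert (hw9 : 0 < w ^ 9) by (apply pow_lt; lra).
(* For [th <= w^2 / 2] the denominator in [G_near] is at most [(1/4 + 1.022) w^4], and
   [5269/1800 / 1.272 > 2.3]. *)
set (al := 23 / 10 / w ^ 6).
assert (hal : 0 < al) by (apply Rdiv_lt_0_compat; lra).
(* The primitive [th exp (- al th^2)] has derivative [(1 - 2 al th^2) exp (- al th^2)], comparable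
   to [- th^2 exp (- al th^2)] past [1.08 w^3]. The number 8136/10000 is
   [1 - 1 / (2 al (1.08 w^3)^2)], rounded down. *)
set (C := exp (1 / 100) / 2 / (8136 / 10000) / (2 * al)).
assert (hC : 0 < C).
{ unfold C. apply Rdiv_lt_0_compat; [|lra]. generalize (exp_pos (1 / 100)). lra. }
assert (H := RInt_ge_primitive f (fun th => C * (th * exp (- al * th ^ 2)))
  (fun th => C * (exp (- al * th ^ 2) - 2 * al * th ^ 2 * exp (- al * th ^ 2)))
  (108 / 100 * w ^ 3) (w ^ 2 / 2) ltac:(nra) (f_int _ _)).
eapply Rle_trans; [clear H|apply H; clear H].
- assert (0 <= C * (w ^ 2 / 2 * exp (- al * (w ^ 2 / 2) ^ 2))).
  { apply Rmult_le_pos; [lra|]. apply Rmult_le_pos; [lra|left; apply exp_pos]. }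
  replace (- al * (108 / 100 * w ^ 3) ^ 2) with (- (INR 8 * (33534 / 100000)))
    by (unfold al; simpl; field; lra).
  assert (N : exp (- (INR 8 * (33534 / 100000))) <= 687 / 10000).
  { apply (exp_neg_le 8 _ (13978 / 10000)); lra. }
  assert (E := exp_100_le). assert (E0 := exp_pos (1 / 100)).
  assert (M : C * (108 / 100 * w ^ 3 * exp (- (INR 8 * (33534 / 100000)))) <= 1002 / 100000 * w ^ 9); [|lra].
  replace (C * (108 / 100 * w ^ 3 * exp (- (INR 8 * (33534 / 100000))))) with
    (w ^ 9 * (exp (1 / 100) * exp (- (INR 8 * (33534 / 100000)))) * (108 / 100 / 2 / (8136 / 10000) / (46 / 10)))
    by (unfold C, al; field; lra).
  assert (exp (1 / 100) * exp (- (INR 8 * (33534 / 100000))) <= 10102 / 10000 * (687 / 10000)).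
  { apply Rmult_le_compat; try lra. left; apply exp_pos. }
  nra.
- intros x. auto_derive; [exact I|]. simpl. ring.
- intros x. auto_derive. exact I.
- intros th hth.
  assert (hth2 : 11664 / 10000 * w ^ 6 <= th ^ 2).
  { replace (11664 / 10000 * w ^ 6) with ((108 / 100 * w ^ 3) ^ 2) by field. apply pow_incr. lra. }
  eapply Rle_trans; [|apply (f_lower_bound th (exp (1 / 100) * exp (- al * th ^ 2)) ltac:(lra))].
  + replace (C * (exp (- al * th ^ 2) - 2 * al * th ^ 2 * exp (- al * th ^ 2))) with
      (exp (1 / 100) * exp (- al * th ^ 2) * ((/ (2 * al) - th ^ 2) / (2 * (8136 / 10000))))
      by (unfold C; field; lra).
    replace (- (th ^ 2 / 2 * (exp (1 / 100) * exp (- al * th ^ 2)))) with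
      (exp (1 / 100) * exp (- al * th ^ 2) * (- th ^ 2 / 2)) by field.
    apply Rmult_le_compat_l; [apply Rmult_le_pos; left; apply exp_pos|].
    assert (J : / (2 * al) = 10 / 46 * w ^ 6) by (unfold al; field; lra). rewrite J. lra.
  + rewrite <- exp_plus.
    assert (hG := G_near th ltac:(lra)).
    assert (hq : - al * th ^ 2 >= - (5269 / 1800 / w ^ 2 * (th ^ 2 / (th ^ 2 + 1022 / 1000 * w ^ 4)))).
    { assert (hw4 : 0 < w ^ 4) by (apply pow_lt; lra). assert (0 < th) by lra.
      assert (th2 : 0 < th ^ 2) by (apply pow_lt; lra).
      assert (th2' : th ^ 2 <= 1 / 4 * w ^ 4).
      { replace (1 / 4 * w ^ 4) with ((w ^ 2 / 2) ^ 2) by field. apply pow_incr. lra. }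
      assert (al * th ^ 2 <= 5269 / 1800 / w ^ 2 * (th ^ 2 / (th ^ 2 + 1022 / 1000 * w ^ 4))); [|lra].
      unfold al.
      apply Rmult_le_reg_r with (w ^ 6 * (th ^ 2 + 1022 / 1000 * w ^ 4)); [apply Rmult_lt_0_compat; lra|].
      replace (23 / 10 / w ^ 6 * th ^ 2 * (w ^ 6 * (th ^ 2 + 1022 / 1000 * w ^ 4))) with
        (th ^ 2 * (23 / 10 * (th ^ 2 + 1022 / 1000 * w ^ 4))) by (field; lra).
      replace (5269 / 1800 / w ^ 2 * (th ^ 2 / (th ^ 2 + 1022 / 1000 * w ^ 4)) * (w ^ 6 * (th ^ 2 + 1022 / 1000 * w ^ 4))) with
        (th ^ 2 * (5269 / 1800 * w ^ 4)) by (field; split; lra).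
      apply Rmult_le_compat_l; lra. }
    destruct (Rle_lt_or_eq_dec (G th) (1 / 100 + - al * th ^ 2) ltac:(lra)) as [h|h];
      [apply Rlt_le, exp_increasing, h|rewrite h; lra].
Qed.

(** The decay in [G_near] grows with [th], so its value at the left end [w^2 / 2] serves throughout:
    [5269/1800 * 0.25 / 1.272 > 0.575]. *)
Lemma piece_mid : - (139 / 100000 * w ^ 9) <= RInt f (w ^ 2 / 2) (3 / 2 * w ^ 2).
Proof.
assert (hw2 : 0 < w ^ 2) by (apply pow_lt; lra). assert (hw4 : 0 < w ^ 4) by (apply pow_lt; lra).
assert (hw' := w_le). assert (hw9 : 0 < w ^ 9) by (apply pow_lt; lra).
set (h := exp (1 / 100) * exp (- (575 / 1000 / w ^ 2))).
assert (H := RInt_ge_primitive f (fun th => - (h * (th ^ 3 / 6))) (fun th => - (h * (th ^ 2 / 2)))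
  (w ^ 2 / 2) (3 / 2 * w ^ 2) ltac:(lra) (f_int _ _)).
eapply Rle_trans; [clear H|apply H; clear H].
- assert (X := exp_neg_div_le 2 (575 / 1000) (w ^ 2) ltac:(lia) ltac:(lra) ltac:(simpl; lra)).
  replace (18 * (575 / 1000)) with (INR 32 * (3234375 / 10000000)) in X by (simpl; lra).
  assert (N : exp (- (INR 32 * (3234375 / 10000000))) <= 33 / 1000000).
  { apply (exp_neg_le 32 _ (138138 / 100000)); lra. }
  assert (E := exp_100_le). assert (E0 := exp_pos (1 / 100)).
  assert (hh : h <= 10102 / 10000 * (33 / 1000000 * (18 * w ^ 2) ^ 2)).
  { unfold h. apply Rmult_le_compat; try lra; [left; apply exp_pos|].
    apply Rle_trans with (1 := X). apply Rmult_le_compat_r; [apply pow2_ge_0|exact N]. }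
  replace (- (h * ((3 / 2 * w ^ 2) ^ 3 / 6)) - - (h * ((w ^ 2 / 2) ^ 3 / 6))) with
    (- (h * (13 / 24 * w ^ 6))) by field.
  apply Ropp_le_contravar.
  assert (hw6 : 0 < w ^ 6) by (apply pow_lt; lra).
  apply Rle_trans with (10102 / 10000 * (33 / 1000000 * (18 * w ^ 2) ^ 2) * (13 / 24 * w ^ 6)).
  { apply Rmult_le_compat_r; lra. }
  replace (10102 / 10000 * (33 / 1000000 * (18 * w ^ 2) ^ 2) * (13 / 24 * w ^ 6)) with
    (10102 / 10000 * (33 / 1000000) * 324 * (13 / 24) * (w * w ^ 9)) by field.
  assert (w * w ^ 9 <= 23571 / 100000 * w ^ 9) by (apply Rmult_le_compat_r; lra). lra.
- intros x. auto_derive; [exact I|]. field.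
- intros x. auto_derive. exact I.
- intros th hth.
  replace (- (h * (th ^ 2 / 2))) with (- (th ^ 2 / 2 * h)) by ring. apply f_lower_bound; [lra|].
  unfold h. rewrite <- exp_plus. assert (hG := G_near th ltac:(lra)).
  assert (hq : 575 / 1000 / w ^ 2 <= 5269 / 1800 / w ^ 2 * (th ^ 2 / (th ^ 2 + 1022 / 1000 * w ^ 4))).
  { assert (th2' : 1 / 4 * w ^ 4 <= th ^ 2).
    { replace (1 / 4 * w ^ 4) with ((w ^ 2 / 2) ^ 2) by field. apply pow_incr. lra. }
    apply Rmult_le_reg_r with (w ^ 2 * (th ^ 2 + 1022 / 1000 * w ^ 4)); [apply Rmult_lt_0_compat; lra|].
    replace (575 / 1000 / w ^ 2 * (w ^ 2 * (th ^ 2 + 1022 / 1000 * w ^ 4))) with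
      (575 / 1000 * (th ^ 2 + 1022 / 1000 * w ^ 4)) by (field; lra).
    replace (5269 / 1800 / w ^ 2 * (th ^ 2 / (th ^ 2 + 1022 / 1000 * w ^ 4)) * (w ^ 2 * (th ^ 2 + 1022 / 1000 * w ^ 4)))
      with (5269 / 1800 * th ^ 2) by (field; split; lra).
    lra. }
  destruct (Rle_lt_or_eq_dec (G th) (1 / 100 + - (575 / 1000 / w ^ 2)) ltac:(lra)) as [e|e];
    [apply Rlt_le, exp_increasing, e|rewrite e; lra].
Qed.

(** The crude bounds [1 - cos th <= 2] and [PI <= 4] suffice, since [exp (- 1.35 / s)] is minute for
    [s <= 1/18]. *)
Lemma piece_far : - (20 / 100000 * w ^ 9) <= RInt f (3 / 2 * w ^ 2) PI.
Proof.
assert (hw2 : 0 < w ^ 2) by (apply pow_lt; lra).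
assert (hw' := w_le). assert (hw9 : 0 < w ^ 9) by (apply pow_lt; lra).
assert (P3 := PI2_3_2). assert (P4 := PI_4).
set (h := exp (1 / 100) * exp (- (135 / 100 / w ^ 2))).
assert (h0 : 0 < h) by (apply Rmult_lt_0_compat; apply exp_pos).
assert (H := RInt_ge_primitive f (fun th => - (h * (2 * th))) (fun th => - (h * 2))
  (3 / 2 * w ^ 2) PI ltac:(nra) (f_int _ _)).
eapply Rle_trans; [clear H|apply H; clear H].
- assert (X := exp_neg_div_le 5 (135 / 100) (w ^ 2) ltac:(lia) ltac:(lra) ltac:(simpl; lra)).
  replace (18 * (135 / 100)) with (INR 64 * (3796875 / 10000000)) in X by (simpl; lra).
  assert (N : exp (- (INR 64 * (3796875 / 10000000))) <= 4 / 100000000000).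
  { apply (exp_neg_le 64 _ (14608 / 10000)); lra. }
  assert (E := exp_100_le). assert (E0 := exp_pos (1 / 100)).
  assert (hh : h <= 10102 / 10000 * (4 / 100000000000 * (18 * w ^ 2) ^ 5)).
  { unfold h. apply Rmult_le_compat; try lra; [left; apply exp_pos|].
    apply Rle_trans with (1 := X). apply Rmult_le_compat_r; [apply pow_le; lra|exact N]. }
  apply Rle_trans with (- (h * 8)); [|nra].
  apply Ropp_le_contravar.
  replace ((18 * w ^ 2) ^ 5) with (1889568 * (w * w ^ 9)) in hh by ring.
  assert (w * w ^ 9 <= 23571 / 100000 * w ^ 9) by (apply Rmult_le_compat_r; lra). lra.
- intros x. auto_derive; [exact I|]. ring.
- intros x. auto_derive. exact I.
- intros th hth. assert (hG := G_far th ltac:(lra)).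
  assert (D : exp (G th) <= h).
  { unfold h. rewrite <- exp_plus.
    destruct (Rle_lt_or_eq_dec (G th) (1 / 100 + - (135 / 100 / w ^ 2)) ltac:(lra)) as [e|e];
    [apply Rlt_le, exp_increasing, e|rewrite e; lra]. }
  unfold f. assert (Q := exp_pos (G th)). assert (C := COS_bound (psi th)). assert (C' := COS_bound th).
  assert (0 <= exp (G th) * (1 - cos th) <= h * 2).
  { split; [apply Rmult_le_pos; lra|apply Rmult_le_compat; lra]. }
  replace (exp (G th) * cos (psi th) * (1 - cos th)) with (exp (G th) * (1 - cos th) * cos (psi th)) by ring.
  nra.
Qed.

(** In units of [w^9 / 100000] the balance is [1329 - 1002 - 139 - 20 = 168]. *)
Lemma tilted_integral_nonneg : 0 <= RInt f 0 PI.
Proof.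
assert (hw9 : 0 < w ^ 9) by (apply pow_lt; lra).
assert (C : forall a b c, RInt f a c = RInt f a b + RInt f b c).
{ intros a b c. symmetry. apply (RInt_Chasles f); apply f_int. }
rewrite (C 0 (9 / 10 * w ^ 3)), (C (9 / 10 * w ^ 3) (108 / 100 * w ^ 3)),
  (C (108 / 100 * w ^ 3) (w ^ 2 / 2)), (C (w ^ 2 / 2) (3 / 2 * w ^ 2)).
assert (P1 := piece_main). assert (P2 := piece_pos). assert (P3 := piece_gauss).
assert (P4 := piece_mid). assert (P5 := piece_far). lra.
Qed.

End Integral.

(** * The saddle point *)

Lemma RInt_even (f : R -> R) (b : R) : (forall x, f (- x) = f x) -> (forall x, ex_derive f x) ->
  RInt f (- b) b = 2 * RInt f 0 b.
Proof.
intros he hd.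
assert (I : forall a c, ex_RInt f a c) by (intros; apply ex_RInt_ex_derive, hd).
assert (C : RInt f (- b) b = RInt f (- b) 0 + RInt f 0 b).
{ symmetry. apply (RInt_Chasles f); apply I. }
assert (S : RInt f (- b) 0 = RInt f 0 b).
{ assert (O : is_RInt f (- b) (- 0) (RInt f (- b) 0)) by (rewrite Ropp_0; apply (RInt_correct f), I).
  rewrite <- (is_RInt_unique _ _ _ _ (is_RInt_comp_opp f b 0 _ O)).
  rewrite (RInt_extR (fun y => opp (f (- y))) (fun y => -1 * f y)).
  - rewrite RInt_scalR by apply I. rewrite <- (opp_RInt_swap f) by apply I.
    unfold opp; simpl. ring.
  - intros x. rewrite he. unfold opp; simpl. ring. }
lra.
Qed.

Lemma lnG_even (L : list nat) (s th : R) : lnG L s (- th) = lnG L s th.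
Proof.
unfold lnG. f_equal. apply sumL_ext. intros j _. unfold lnmod, modsq.
rewrite <- Ropp_mult_distr_r, cos_neg. reflexivity.
Qed.

Lemma phase_odd (L : list nat) (s th : R) : phase L s (- th) = - phase L s th.
Proof.
unfold phase. rewrite <- (Rmult_1_l (sumL L (fun j => arg1 (rho s j) (INR j * th)))), Ropp_mult_distr_l, <- sumL_scal.
apply sumL_ext. intros j _. unfold arg1.
rewrite <- Ropp_mult_distr_r, cos_neg, sin_neg.
replace (rho s j * - sin (INR j * th) / (1 - rho s j * cos (INR j * th))) with
  (- (rho s j * sin (INR j * th) / (1 - rho s j * cos (INR j * th)))) by (unfold Rdiv; ring).
rewrite atan_opp. ring.
Qed.

Lemma RInt_nonneg_at_mean (L : list nat) (N n : nat) (s : R) : two_or_three L N ->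
  0 < s <= 1 / 18 -> 1000 <= INR N * s ^ 2 -> mean L s = INR n ->
  0 <= RInt (fun th => exp (lnG L s th) * cos (phase L s th - INR n * th) * (1 - cos th)) (- PI) PI.
Proof.
intros hL hs hN hm. assert (hp := proj1 hL).
set (F := fun th => exp (lnG L s th) * cos (phase L s th - INR n * th) * (1 - cos th)).
assert (dF : forall x, ex_derive F x).
{ intros x. unfold F. auto_derive. destruct hs. splits; ex_derive_tac. }
rewrite RInt_even; [|intros x; unfold F; rewrite lnG_even, phase_odd, cos_neg|exact dF].
2: { replace (- phase L s x - INR n * - x) with (- (phase L s x - INR n * x)) by ring.
     rewrite cos_neg. reflexivity. }
set (w := sqrt s).
assert (hw : 0 < w) by (apply sqrt_lt_R0; lra).
assert (E2 : w ^ 2 = s) by (apply pow2_sqrt; lra).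
assert (E4 : w ^ 4 = s ^ 2) by (rewrite <- E2; ring).
assert (E6 : w ^ 6 = s ^ 3) by (rewrite <- E2; ring).
assert (E8 : w ^ 8 = s ^ 4) by (rewrite <- E2; ring).
assert (T := tilted_integral_nonneg (fun th => lnG L s th - lnG L s 0)
  (fun th => phase L s th - INR n * th) w hw).
rewrite E2, E4, E6, E8 in T.
assert (P : 0 <= RInt (fun th => exp (lnG L s th - lnG L s 0) * cos (phase L s th - INR n * th) * (1 - cos th)) 0 PI).
{ apply T; clear T.
  - lra.
  - intros x. auto_derive. destruct hs. splits; ex_derive_tac.
  - intros x. auto_derive. destruct hs. splits; ex_derive_tac.
  - intros th _. apply (lnG_ge L N); tauto.
  - intros th hth. rewrite <- hm. apply (phase_bound L N); tauto.
  - intros th hth. apply (lnG_le_near L N); assumption.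
  - intros th hth. apply (lnG_le_far L N); assumption. }
apply Rmult_le_pos; [lra|].
rewrite (RInt_extR F (fun th => exp (lnG L s 0) *
  (exp (lnG L s th - lnG L s 0) * cos (phase L s th - INR n * th) * (1 - cos th)))).
- rewrite RInt_scalR; [apply Rmult_le_pos; [left; apply exp_pos|exact P]|].
  apply ex_RInt_ex_derive. intros x. auto_derive. destruct hs. splits; ex_derive_tac.
- intros th. unfold F. replace (lnG L s th) with (lnG L s 0 + (lnG L s th - lnG L s 0)) at 1 by ring.
  rewrite exp_plus. ring.
Qed.

Lemma mean_continuous (L : list nat) (s : R) : all_pos L -> 0 < s -> continuity_pt (mean L) s.
Proof.
intros hL hs. apply continuity_pt_filterlim. apply (ex_derive_continuous (mean L) s).
unfold mean. apply (ex_derive_sumL L (fun j s => INR j * g0 (rho s j))).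
eapply List.Forall_impl; [|exact hL]. intros j hj. cbn beta.
assert (hr := rho_bounds s j hs hj). unfold g0, rho in *. auto_derive. splits. lra.
Qed.

(** Intermediate values: at [s = 1/18] the mean is at most [400/81 * 18^2 = 1600], while at
    [s = 1/n] the part 1 alone contributes at least [2 (n - 1) > n]. *)
Lemma exists_saddle (L : list nat) (N n : nat) : two_or_three L N -> (1 <= N)%nat -> (1600 <= n)%nat ->
  exists s, / INR n <= s <= 1 / 18 /\ mean L s = INR n.
Proof.
intros hL hN hn. assert (hp := proj1 hL).
assert (hn' : 1600 <= INR n).
{ replace 1600 with (INR 1600) by (rewrite INR_IZR_INZ; reflexivity). apply le_INR, hn. }
assert (hi : 0 < / INR n) by (apply Rinv_0_lt_compat; lra).
assert (hi' : / INR n <= / 1600) by (apply Rinv_le_contravar; lra).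
assert (Hi : mean L (1 / 18) <= INR n).
{ apply Rle_trans with (1 := mean_le L N (1 / 18) hL ltac:(lra)). lra. }
assert (Lo : INR n < mean L (/ INR n)).
{ destruct hL as [_ hb]. unfold mean.
  destruct (hb (fun j => INR j * g0 (rho (/ INR n) j))) as [H _].
  { intros j hj. destruct (rho_nonneg_g _ j hi hj) as [? [? _]]. nra. }
  apply Rlt_le_trans with (2 := H).
  assert (G : INR 1 * g0 (rho (/ INR n) 1) <= sumL (seq 1 N) (fun j => INR j * g0 (rho (/ INR n) j))).
  { destruct N as [|N]; [lia|]. cbn [seq].
    change (sumL (1%nat :: seq 2 N) (fun j => INR j * g0 (rho (/ INR n) j))) with
      (INR 1 * g0 (rho (/ INR n) 1) + sumL (seq 2 N) (fun j => INR j * g0 (rho (/ INR n) j))).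
    assert (0 <= sumL (seq 2 N) (fun j => INR j * g0 (rho (/ INR n) j))); [|lra].
    apply sumL_nonneg. intros j hj. apply in_seq in hj.
    destruct (rho_nonneg_g (/ INR n) j hi ltac:(lia)) as [? [? _]]. nra. }
  assert (K : INR n - 1 <= g0 (rho (/ INR n) 1)).
  { unfold g0, rho. simpl INR. rewrite Rmult_1_l. set (x := / INR n) in *.
    assert (hr := exp_neg_lt1 x hi). assert (Y := exp_neg_inv x).
    assert (U := exp_le_inv_one_sub x ltac:(lra)).
    replace (INR n) with (/ x) by (unfold x; apply Rinv_inv).
    assert (hx : 1 - x <= exp (- x)) by (generalize (exp_ineq1_le (- x)); lra).
    apply Rmult_le_reg_r with (x * (1 - exp (- x))); [nra|].
    replace ((/ x - 1) * (x * (1 - exp (- x)))) with ((1 - x) * (1 - exp (- x))) by (field; lra).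
    replace (exp (- x) / (1 - exp (- x)) * (x * (1 - exp (- x)))) with (x * exp (- x)) by (field; lra).
    nra. }
  simpl (INR 1) in G. lra. }
destruct (Rle_lt_or_eq_dec _ _ Hi) as [Hlt|Heq]; [|exists (1 / 18); split; [lra|exact Heq]].
destruct (Ranalysis5.IVT_interv (fun s => INR n - mean L s) (/ INR n) (1 / 18)) as [s [h1 h2]].
- intros a ha. apply continuity_pt_minus; [apply continuity_pt_const; intros ? ?; reflexivity|].
  apply mean_continuous; [exact hp|lra].
- lra.
- lra.
- lra.
- exists s. split; [exact h1|]. lra.
Qed.

(** The parameter [M] lets [N] exceed any index of interest, so that the truncated coefficients are
    the true ones. The term [1000 n^2] ensures [N s^2 >= 1000], as [s >= 1/n]. *)
Theorem partgf_log_concave (L : nat -> list nat) : (forall N, two_or_three (L N) N) ->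
  forall n M, (1600 <= n)%nat -> exists N, (M <= N)%nat /\
    (partgf (L N) (n - 1) * partgf (L N) (n + 1) <= partgf (L N) n * partgf (L N) n)%Z.
Proof.
intros hL n M hn. exists (M + 1000 * (n * n))%nat. split; [lia|].
set (N := (M + 1000 * (n * n))%nat).
destruct (exists_saddle (L N) N n (hL N) ltac:(unfold N; nia) hn) as [s [hs hm]].
assert (hn' : 0 < INR n) by (apply lt_0_INR; lia).
assert (hi : 0 < / INR n) by (apply Rinv_0_lt_compat; lra).
apply (log_concave_of_RInt (L N) s n); [lra|apply hL|lia|].
apply (RInt_nonneg_at_mean (L N) N); [apply hL|lra| |exact hm].
assert (hs2 : (/ INR n) ^ 2 <= s ^ 2) by (apply pow_incr; lra).
assert (hN : 1000 * (INR n * INR n) <= INR N).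
{ replace 1000 with (INR 1000) by (rewrite INR_IZR_INZ; reflexivity).
  rewrite <- !mult_INR. apply le_INR. unfold N. lia. }
apply Rle_trans with (1000 * (INR n * INR n) * (/ INR n) ^ 2).
- apply Req_le. field. lra.
- apply Rmult_le_compat; try lra; [|apply pow2_ge_0].
  assert (0 <= INR n * INR n) by nra. lra.
Qed.

Definition parts (c : nat -> nat) (N : nat) : list nat :=
  flat_map (fun j => repeat j (c j)) (seq 1 N).

Lemma two_or_three_parts (c : nat -> nat) (N : nat) : (forall j, (2 <= c j <= 3)%nat) ->
  two_or_three (parts c N) N.
Proof.
intros hc. split.
- apply List.Forall_forall. intros j hj. apply in_flat_map in hj.
  destruct hj as [i [hi hj]]. apply repeat_spec in hj. apply in_seq in hi. lia.
- intros h hh. unfold parts.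
  assert (E : forall l, sumL (flat_map (fun j => repeat j (c j)) l) h = sumL l (fun j => INR (c j) * h j)).
  { induction l as [|j l IH]; [reflexivity|]. cbn [flat_map]. rewrite sumL_app, IH. simpl sumL at 3.
    f_equal. generalize (c j). intros n. induction n as [|n IHn]; [simpl; ring|].
    rewrite S_INR. cbn [repeat sumL fold_right]. fold (sumL (repeat j n) h). rewrite IHn. ring. }
  rewrite E, <- !sumL_scal.
  assert (B : forall j, 2 <= INR (c j) <= 3).
  { intros j. destruct (hc j) as [h2 h3]. apply le_INR in h2, h3. simpl in h2, h3. lra. }
  split; apply sumL_le; intros j hj; apply in_seq in hj;
    (apply Rmult_le_compat_r; [apply hh; lia|apply B]).
Qed.

End Analysis.

(** * Small indices *)

Section SmallIndices.

Local Open Scope Z_scope.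

(* A power series is the list of its first coefficients.  A sparse series without
   constant term is coded by the signs of its monomials and the gaps between their
   exponents, so that [dot] walks once through the reversed prefix [ys]. *)
Fixpoint dot (gs : list (bool * nat)) (ys : list Z) : Z :=
  match gs with
  | nil => 0
  | (s, d) :: gs' =>
    match skipn d ys with
    | nil => 0
    | (y :: _) as zs => if s then dot gs' zs + y else dot gs' zs - y
    end
  end.

Fixpoint series_mul (gs : list (bool * nat)) (l acc : list Z) : list Z :=
  match l with
  | nil => nil
  | y :: l' => (y + dot gs (y :: acc)) :: series_mul gs l' (y :: acc)
  end.

(** Division by one plus the coded series; [acc] is the reversed prefix of the quotient. The [0]
    holds the place of the coefficient being computed and has no effect when the first gap is
    positive. *)
Fixpoint series_div (gs : list (bool * nat)) (l acc : list Z) : list Z :=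
  match l with
  | nil => nil
  | y :: l' => let x := y - dot gs (0 :: acc) in x :: series_div gs l' (x :: acc)
  end.

(* Gaps, multiplied by [d], between consecutive generalized pentagonal numbers
   [k (3 k - 1) / 2], [k (3 k + 1) / 2], with the sign of the monomial. *)
Definition gaps (d k0 K : nat) : list (bool * nat) :=
  flat_map (fun k => (Nat.even k, (2 * k - 1) * d)%nat :: (Nat.even k, k * d)%nat :: nil) (seq k0 K).

Fixpoint log_concave_list (l : list Z) : bool :=
  match l with
  | a :: ((b :: c :: _) as t) => (a * c <=? b * b) && log_concave_list t
  | _ => true
  end.

(* [33] pairs suffice: the next pentagonal number is [1717]. *)
Definition euler_quotient (N : nat) : list Z :=
  let g := gaps 1 1 33 in
  series_div g (series_div g (series_div g (series_mul (gaps 2 1 33) (1 :: repeat 0 N) nil) nil) nil) nil.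

(** Kept apart from [euler_quotient] so that this common factor is computed only once for [m = 3]
    and [m = 5]. *)
Definition diamond_of (m : nat) (l : list Z) : list Z :=
  series_div (gaps (2 * m) 1 33) (series_mul (gaps m 1 33) l nil) nil.

Definition diamond_list (m N : nat) : list Z := diamond_of m (euler_quotient N).

Definition diamond_check (N : nat) : bool :=
  let l := euler_quotient N in
  log_concave_list (diamond_of 3 l) && log_concave_list (diamond_of 5 l).

(** The coefficients up to index 1601 settle the inequality for [n <= 1600]; the evaluation is left
    to the virtual machine when the proof is closed. *)
Lemma diamond_check_1601 : diamond_check 1601 = true.
Proof. vm_cast_no_check (eq_refl true). Qed.

Lemma log_concave_listP (l : list Z) (i : nat) : log_concave_list l = true ->
  (S (S i) < length l)%nat -> nth i l 0 * nth (S (S i)) l 0 <= nth (S i) l 0 * nth (S i) l 0.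
Proof.
revert i; induction l as [|a l IH]; intros i; [simpl; lia|].
destruct l as [|b [|c l]]; try (simpl; lia).
intros H hi. simpl in H. apply andb_prop in H. destruct H as [H1 H2].
destruct i as [|i].
- simpl. apply Z.leb_le, H1.
- apply (IH i); [exact H2|]. simpl in *. lia.
Qed.

Lemma diamond_list_log_concave (m N i : nat) : m = 3%nat \/ m = 5%nat ->
  diamond_check N = true -> (S (S i) < length (diamond_list m N))%nat ->
  nth i (diamond_list m N) 0 * nth (S (S i)) (diamond_list m N) 0 <=
  nth (S i) (diamond_list m N) 0 * nth (S i) (diamond_list m N) 0.
Proof.
intros hm H. apply log_concave_listP.
apply andb_prop in H. destruct H as [H3 H5]. destruct hm as [->| ->]; assumption.
Qed.

End SmallIndices.

Require Import Defs.
From mathcomp Require Import all_boot all_order all_algebra.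
From mathcomp Require Import zify ssrZ ring.

Set Implicit Arguments.
Unset Strict Implicit.
Unset Printing Implicit Defensive.

Import GRing.Theory Num.Theory.
Local Open Scope ring_scope.

(** * The pentagonal number theorem *)

Definition tri (k : nat) : nat := 'C(k.+1, 2).
Arguments tri : simpl never.

Lemma triS (k : nat) : tri k.+1 = (tri k + k.+1)%N.
Proof. by rewrite /tri binS bin1. Qed.

(** The term [k = 0] is the product of [1 - x^i] for [i <= n], and every other term is divisible by
    [x^(n+1)]; so this agrees with Euler's product through degree [n]. *)
Definition shanks (R : comNzRingType) (x : R) (n : nat) : R :=
  \sum_(0 <= k < n.+1) (-1) ^+ k * (\prod_(k.+1 <= i < n.+1) (1 - x ^+ i)) * x ^+ (n * k + tri k).

(* Shanks' finite form of Euler's pentagonal number theorem: the summand telescopes. *)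
Lemma shanksS (R : comNzRingType) (x : R) (n : nat) :
  shanks x n.+1 = shanks x n +
    (-1) ^+ n.+1 * (x ^+ (n * n.+1 + tri n.+1) + x ^+ (n.+1 * n.+1 + tri n.+1)).
Proof.
(* The telescoping certificate: consecutive differences of [h] are the changes of the summands from
   [n] to [n + 1], and [h 0 = 0] because its product contains [1 - x^0]. *)
pose h k := (-1) ^+ k * ((\prod_(k <= i < n.+1) (1 - x ^+ i)) * x ^+ (n * k + tri k)).
rewrite {1}/shanks big_nat_recr //= [\prod_(n.+2 <= i < n.+2) _]big_geq // mulr1.
rewrite mulrDr addrA; congr (_ + _).
apply/eqP; rewrite -subr_eq addrC; apply/eqP.
have -> : (-1) ^+ n.+1 * x ^+ (n * n.+1 + tri n.+1) = h n.+1 - h 0%N.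
  rewrite /h big_geq // mul1r expr0 mul1r big_ltn // expr0 subrr !mul0r subr0 //.
rewrite -telescope_sumr // /shanks addrC -sumrB; apply: eq_big_nat => k /andP[_ lekn].
rewrite /h big_nat_recr // [\prod_(k <= i < n.+1) _]big_ltn // triS.
move: (\prod_(_ <= i < _) _) => P; move: (tri k) => t.
rewrite mulnS mulSn !exprD !exprS.
move: ((-1) ^+ k) (x ^+ k) (x ^+ n) (x ^+ (n * k)) (x ^+ t) => a b c e f.
by rewrite /=; ring.
Qed.

(** The generalized pentagonal numbers [k (3 k - 1) / 2] and, for [pent_hi], [k (3 k + 1) / 2], in
    the shape in which [shanksS] delivers them. *)
Definition pent_lo (k : nat) : nat := (k.-1 * k + tri k)%N.
Definition pent_hi (k : nat) : nat := (k * k + tri k)%N.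

Lemma shanksE (R : comNzRingType) (x : R) (n : nat) :
  shanks x n = 1 + \sum_(1 <= k < n.+1) (-1) ^+ k * (x ^+ pent_lo k + x ^+ pent_hi k).
Proof.
elim: n => [|n IH].
  by rewrite /shanks big_nat1 !big_geq // addr0 mulr1 mul1r mul0n add0n.
by rewrite shanksS IH [in RHS]big_nat_recr //= addrA.
Qed.

(** * Sparse multiplication and division of truncated series *)

Lemma int_of_ZD a b : int_of_Z (Z.add a b) = int_of_Z a + int_of_Z b.
Proof. by rewrite -[Z.add a b]/(GRing.add a b) rmorphD. Qed.

Lemma int_of_Z_le a b : Z.le a b -> int_of_Z a <= int_of_Z b.
Proof. lia. Qed.

Lemma int_of_ZM a b : int_of_Z (Z.mul a b) = int_of_Z a * int_of_Z b.
Proof. by rewrite -[Z.mul a b]/(GRing.mul a b) rmorphM. Qed.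

Definition nthZ (l : seq Z) (i : nat) : int := int_of_Z (nth Z0 l i).

Definition polyZ (l : seq Z) : {poly int} := Poly [seq int_of_Z x | x <- l].

Lemma coef_polyZ l i : (polyZ l)`_i = nthZ l i.
Proof.
rewrite coef_Poly /nthZ; case: (ltnP i (size l)) => hi; first by rewrite (nth_map Z0).
by rewrite !nth_default ?size_map.
Qed.

Fixpoint spoly (gs : seq (bool * nat)) : {poly int} :=
  if gs is (s, d) :: gs' then 'X^d * ((-1) ^+ (~~ s) + spoly gs') else 0.

Lemma skipn_drop (T : Type) d (l : seq T) : List.skipn d l = drop d l.
Proof. by elim: d l => [|d IH] [|x l] //=. Qed.

Lemma int_of_ZB a b : int_of_Z (Z.sub a b) = int_of_Z a - int_of_Z b.
Proof. by rewrite -[Z.sub a b]/(GRing.add a (GRing.opp b)) rmorphB. Qed.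

Lemma dotE gs ys :
  int_of_Z (dot gs ys) = \sum_(0 <= e < size ys) (spoly gs)`_e * nthZ ys e.
Proof.
elim: gs ys => [|[s d] gs IH] ys; first by rewrite big1 // => e _; rewrite coef0 mul0r.
rewrite [dot _ _]/= skipn_drop.
case: (leqP (size ys) d) => hd.
  rewrite drop_oversize // big_nat big1 // => e /andP[_ he].
  by rewrite coefXnM (leq_trans he hd) mul0r.
rewrite (drop_nth Z0 hd); set zs := drop d.+1 ys.
rewrite (big_cat_nat (n := d)) ?(ltnW hd) //= [X in X + _]big_nat [X in X + _]big1 => [|e /andP[_ he]]; last first.
  by rewrite coefXnM he mul0r.
rewrite add0r -[X in \sum_(X <= _ < _) _]add0n big_addn.
have hsz : (size ys - d = (size zs).+1)%N by rewrite size_drop; lia.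
rewrite hsz.
rewrite (eq_bigr (fun e => ((-1) ^+ (~~ s) : {poly int})`_e * nthZ ys (e + d) +
   (spoly gs)`_e * nthZ (nth Z0 ys d :: zs) e)); last first.
  move=> e _; rewrite coefXnM ltnNge leq_addl /= addnK coefD mulrDl; congr (_ + _ * _).
  by rewrite -(drop_nth Z0 hd) /nthZ nth_drop addnC.
rewrite big_split /= -(IH (nth Z0 ys d :: zs)).
rewrite big_nat_recl // add0n big1 => [|e _]; last first.
  by case: (s); rewrite ?expr0 ?expr1 ?coefN coef1 /= ?oppr0 mul0r.
rewrite addr0; case: (s); rewrite /= ?expr0 ?expr1 ?coefN coef1 /=.
  by rewrite int_of_ZD mul1r addrC.
by rewrite int_of_ZB mulN1r addrC.
Qed.

Lemma conv_head (p : {poly int}) acc y t :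
  \sum_(0 <= e < (size acc).+1) (1 + p)`_e * nthZ (rev acc ++ y :: t) (size acc - e) =
  int_of_Z y + \sum_(0 <= e < (size acc).+1) p`_e * nthZ (y :: acc) e.
Proof.
rewrite (eq_big_nat _ _ (F2 := fun e => (e == 0%N)%:R * nthZ (y :: acc) e + p`_e * nthZ (y :: acc) e)).
  rewrite big_split /= big_nat_recl //= mul1r big1 ?addr0 // => e _; exact: mul0r.
move=> e /andP[_ he]; rewrite coefD coef1 mulrDl.
suff -> : nthZ (rev acc ++ y :: t) (size acc - e) = nthZ (y :: acc) e by [].
rewrite -cat_rcons -rev_cons /nthZ nth_cat size_rev /= ltnS leq_subr nth_rev /= ?ltnS ?leq_subr //.
by rewrite subSS subKn.
Qed.

Lemma size_series_mul gs l acc : size (series_mul gs l acc) = size l.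
Proof. by elim: l acc => //= y l IH acc; rewrite IH. Qed.

Lemma size_series_div gs l acc : size (series_div gs l acc) = size l.
Proof. by elim: l acc => //= y l IH acc; rewrite IH. Qed.

Lemma series_mulE gs l acc i : (i < size l)%N ->
  nthZ (series_mul gs l acc) i =
  \sum_(0 <= e < (size acc + i).+1) (1 + spoly gs)`_e * nthZ (rev acc ++ l) (size acc + i - e).
Proof.
elim: l acc i => // y l IH acc [_|i hi].
  rewrite addn0 conv_head [LHS]/nthZ /= int_of_ZD; congr (_ + _).
  exact: (dotE gs (y :: acc)).
by rewrite [LHS]/nthZ /= -/(nthZ _ _) IH // rev_cons cat_rcons /= addSnnS.
Qed.

Lemma series_divE gs l acc i : (spoly gs)`_0 = 0 -> (i < size l)%N ->
  \sum_(0 <= e < (size acc + i).+1)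
     (1 + spoly gs)`_e * nthZ (rev acc ++ series_div gs l acc) (size acc + i - e) = nthZ l i.
Proof.
move=> s0; elim: l acc i => // y l IH acc i hi.
rewrite [series_div _ _ _]/=; set x := Z.sub y _.
case: i hi => [_|i hi].
  rewrite addn0 conv_head /x int_of_ZB (dotE gs (_ :: acc)) /=.
  rewrite !big_nat_recl // s0 !mul0r !add0r.
  by rewrite (eq_bigr (fun e => (spoly gs)`_e.+1 * nthZ acc e)) // subrK.
by have := IH (x :: acc) i hi; rewrite rev_cons cat_rcons /= addSnnS.
Qed.

Lemma even_odd k : Nat.even k = ~~ odd k.
Proof. by elim: k => // k IH; rewrite PeanoNat.Nat.even_succ -PeanoNat.Nat.negb_even IH. Qed.

Lemma gapsS d k n : gaps d k n.+1 =
  (Nat.even k, (2 * k - 1) * d)%N :: (Nat.even k, k * d)%N :: gaps d k.+1 n.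
Proof. by []. Qed.

Lemma spoly_cons s d gs : spoly ((s, d) :: gs) = 'X^d * ((-1) ^+ (~~ s) + spoly gs).
Proof. by []. Qed.

(** The leading power turns relative gaps into absolute exponents: from [pent_hi k], a gap of
    [2 k + 1] leads to [pent_lo (k + 1)], and a further gap of [k + 1] to [pent_hi (k + 1)]. *)
Lemma gaps_spoly d k n :
  'X^d ^+ pent_hi k * spoly (gaps d k.+1 n) =
  \sum_(k.+1 <= i < (k + n).+1) (-1) ^+ i * ('X^d ^+ pent_lo i + 'X^d ^+ pent_hi i).
Proof.
elim: n k => [|n IH] k; first by rewrite mulr0 addn0 big_geq.
rewrite gapsS !spoly_cons -[(k + n.+1)%N]addSnnS big_ltn ?ltnS ?leq_addr // -IH.
rewrite even_odd negbK signr_odd.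
have e1 : 'X^((2 * k.+1 - 1) * d) = 'X^d ^+ (2 * k.+1 - 1) :> {poly int} by rewrite -exprM mulnC.
have e2 : 'X^(k.+1 * d) = 'X^d ^+ k.+1 :> {poly int} by rewrite -exprM mulnC.
have -> : pent_lo k.+1 = (pent_hi k + (2 * k.+1 - 1))%N by rewrite /pent_lo /pent_hi triS /=; lia.
have -> : pent_hi k.+1 = (pent_hi k + (2 * k.+1 - 1) + k.+1)%N by rewrite /pent_hi triS; lia.
rewrite e1 e2; move: (pent_hi k) (2 * k.+1 - 1)%N k.+1 (spoly _) => i j l q.
by rewrite !exprD; ring.
Qed.

Lemma gaps_coef0 d n : (0 < d)%N -> (spoly (gaps d 1 n))`_0 = 0.
Proof.
by move=> hd; case: n => [|n]; rewrite ?coef0 // gapsS spoly_cons coefXnM muln1 mul1n hd.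
Qed.

(** * Identification of the coefficients *)

Section Truncation.

Variable N : nat.

(** Congruence modulo ['X^(N+1)]: power series identities become statements about polynomials, and
    divisions are written as multiplied-out equations. *)
Definition eqX (p q : {poly int}) : Prop := forall i, (i <= N)%N -> p`_i = q`_i.

Lemma eqX_sym p q : eqX p q -> eqX q p.
Proof. by move=> H i hi; rewrite H. Qed.

Lemma eqX_trans p q r : eqX p q -> eqX q r -> eqX p r.
Proof. by move=> H H' i hi; rewrite H ?H'. Qed.

Lemma eqXD p p' q q' : eqX p p' -> eqX q q' -> eqX (p + q) (p' + q').
Proof. by move=> H H' i hi; rewrite !coefD H ?H'. Qed.

Lemma eqXM p p' q q' : eqX p p' -> eqX q q' -> eqX (p * q) (p' * q').
Proof.
move=> H H' i hi; rewrite !coefM; apply: eq_bigr => -[j /= ltj] _.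
by rewrite H ?H' //; [apply: leq_trans (leq_subr _ _) hi | apply: leq_trans hi].
Qed.

Lemma eqX_sum0 (I : eqType) (s : seq I) (F : I -> {poly int}) :
  (forall i, i \in s -> eqX (F i) 0) -> eqX (\sum_(i <- s) F i) 0.
Proof.
elim: s => [|a s IH] H; first by rewrite big_nil.
rewrite big_cons -[X in eqX _ X](addr0 0); apply: eqXD; first by apply: H; rewrite mem_head.
by apply: IH => i hi; apply: H; rewrite inE hi orbT.
Qed.

Lemma eqX_prod (I : eqType) (s : seq I) (F G : I -> {poly int}) :
  (forall i, i \in s -> eqX (F i) (G i)) -> eqX (\prod_(i <- s) F i) (\prod_(i <- s) G i).
Proof.
elim: s => [|a s IH] H; first by rewrite !big_nil.
rewrite !big_cons; apply: eqXM; first by apply: H; rewrite mem_head.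
by apply: IH => i hi; apply: H; rewrite inE hi orbT.
Qed.

Lemma eqX_cancel (u p q : {poly int}) : u`_0 = 1 -> eqX (u * p) (u * q) -> eqX p q.
Proof.
move=> u0 H; elim/ltn_ind => i IH hi.
have := H i hi; rewrite !coefM !big_ord_recl /= !u0 !mul1r !subn0.
rewrite (eq_bigr (fun j : 'I_i => u`_(bump 0 j) * q`_(i - bump 0 j))); first by move/addIr.
move=> j _; rewrite IH //; first by rewrite /bump /= ltn_subrL (leq_ltn_trans _ (ltn_ord j)).
exact: leq_trans (leq_subr _ _) hi.
Qed.

Lemma eqX_Xn0 n p : (N < n)%N -> eqX ('X^n * p) 0.
Proof. by move=> ltn i hi; rewrite coefXnM coef0 (leq_ltn_trans hi ltn). Qed.

Definition trunc (f : nat -> int) : {poly int} := \poly_(i < N.+1) f i.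

Lemma coef_trunc f i : (i <= N)%N -> (trunc f)`_i = f i.
Proof. by move=> hi; rewrite coef_poly ltnS hi. Qed.

Lemma trunc_mul f g : eqX (trunc (fps_mul f g)) (trunc f * trunc g).
Proof.
move=> i hi; rewrite coef_trunc // coefM; apply: eq_bigr => -[j /= ltj] _.
by rewrite !coef_trunc //; [apply: leq_trans (leq_subr _ _) hi | apply: leq_trans hi].
Qed.

Lemma trunc_one : eqX (trunc fps_one) 1.
Proof. by move=> i hi; rewrite coef_trunc // coef1. Qed.

Definition omX (j : nat) : {poly int} := 1 - 'X^j.

Lemma trunc_one_sub_q j : eqX (trunc (one_sub_q j)) (omX j).
Proof. by move=> i hi; rewrite coef_trunc // coefB coef1 coefXn. Qed.

Lemma omX_coef0 j : (0 < j)%N -> (omX j)`_0 = 1.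
Proof. by move=> hj; rewrite coefB coef1 coefXn (ltn_eqF hj) subr0. Qed.

Lemma omX_eq1 j : (N < j)%N -> eqX (omX j) 1.
Proof.
move=> hj i hi; rewrite coefB coefXn (ltn_eqF (leq_ltn_trans hi hj)) subr0 //.
Qed.

Definition eulerX (d : nat) : {poly int} := \prod_(1 <= i < N.+1) omX (d * i).

Lemma coef0_mul_eq1 (p q : {poly int}) : p`_0 = 1 -> q`_0 = 1 -> (p * q)`_0 = 1.
Proof. by move=> p0 q0; rewrite coef0M p0 q0 mulr1. Qed.

Lemma eulerX_coef0 d : (0 < d)%N -> (eulerX d)`_0 = 1.
Proof.
move=> hd; rewrite /eulerX big_seq; apply: (big_ind (fun p : {poly int} => p`_0 = 1)).
- by rewrite coef1.
- exact: coef0_mul_eq1.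
- by move=> i; rewrite mem_index_iota => /andP[hi _]; apply: omX_coef0; rewrite muln_gt0 hd.
Qed.

(** Two truncations: modulo ['X^(N+1)] only the term [k = 0] of [shanks] remains, and the monomials
    beyond [K] vanish since their exponents are at least [pent_lo (K + 1)]. *)
Lemma eulerX_pentagonal d K : (0 < d)%N -> (K <= N)%N -> (N < pent_lo K.+1)%N ->
  eqX (eulerX d) (1 + \sum_(1 <= k < K.+1) (-1) ^+ k * ('X^d ^+ pent_lo k + 'X^d ^+ pent_hi k)).
Proof.
move=> hd leKN hK.
have dge n : (n <= d * n)%N by rewrite leq_pmull.
apply: (@eqX_trans _ (shanks 'X^d N)).
  rewrite /shanks big_nat_recl // expr0 mul1r muln0 /= expr0 mulr1.
  rewrite -[X in eqX X _]addr0; apply: eqXD.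
    move=> i _; congr (_`_i); rewrite /eulerX /omX.
    by under eq_bigr do rewrite exprM.
  apply: eqX_sym; apply: eqX_sum0 => k; rewrite mem_index_iota => /andP[_ hk].
  rewrite mulrC -exprM; apply: eqX_Xn0; apply: leq_trans (dge _).
  by rewrite mulnS triS; lia.
rewrite shanksE; apply: eqXD => //.
rewrite (big_cat_nat (n := K.+1)) //= -[X in eqX _ X]addr0; apply: eqXD => //.
apply: eqX_sum0 => k; rewrite mem_index_iota => /andP[hk _].
have mono a b : (a <= b)%N -> (tri a <= tri b)%N.
  elim: b => [|b IH]; first by rewrite leqn0 => /eqP->.
  rewrite leq_eqVlt => /orP[/eqP-> //|/IH h].
  by rewrite triS (leq_trans h) ?leq_addr.
have hp1 : (pent_lo K.+1 <= pent_lo k)%N by apply: leq_add (mono _ _ hk); apply: leq_mul; lia.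
have hp2 : (pent_lo k <= pent_hi k)%N by rewrite leq_add2r leq_mul2r leq_pred orbT.
rewrite mulrC mulrDl -!exprM -[X in eqX _ X](addr0 0); apply: eqXD; apply: eqX_Xn0.
  by apply: leq_trans (dge _); apply: leq_trans hp1.
by apply: leq_trans (dge _); apply: leq_trans hK (leq_trans hp1 hp2).
Qed.

Lemma prod_omX_dvd d M : (0 < d)%N ->
  \prod_(1 <= j < M.+1) omX j ^+ (d %| j) = \prod_(1 <= i < (M %/ d).+1) omX (d * i).
Proof.
move=> hd; elim: M => [|M IH]; first by rewrite div0n !big_geq.
rewrite big_nat_recr //= IH divnS //.
case: (boolP (d %| M.+1)%N) => [hdv|_]; last by rewrite expr0 mulr1 add0n.
rewrite expr1 add1n [in RHS]big_nat_recr //=; congr (_ * omX _).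
by rewrite -{1}(divnK hdv) divnS // hdv mulnC.
Qed.

Lemma eulerX_dvd d : (0 < d)%N -> eqX (\prod_(1 <= j < N.+1) omX j ^+ (d %| j)) (eulerX d).
Proof.
move=> hd; rewrite prod_omX_dvd // /eulerX.
rewrite (big_cat_nat (n := (N %/ d).+1) (p := N.+1)) //=; last by rewrite ltnS leq_div.
rewrite -[X in eqX X _]mulr1; apply: eqXM => //; apply: eqX_sym.
rewrite -[X in eqX _ X](big1_eq (idx := 1) (op := *%R) (index_iota (N %/ d).+1 N.+1) xpredT).
apply: eqX_prod => i; rewrite mem_index_iota => /andP[hi _].
by apply: omX_eq1; rewrite mulnC -ltn_divLR.
Qed.

Lemma eulerX1 : eulerX 1 = \prod_(1 <= j < N.+1) omX j.
Proof. by rewrite /eulerX; under eq_bigr do rewrite mul1n. Qed.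

(* Exponent of [1 / (1 - q^j)] in the generating function, for [m = 2 k + 1]. *)
Definition part_mult (m j : nat) : nat := if odd j && ~~ (m %| j)%N then 3 else 2.

(** As [m] is odd, [[2m | j] = [2 | j] [m | j]], and therefore [3 - [2 | j] - [m | j] + [2m | j] = 2
    + (1 - [2 | j]) (1 - [m | j])]. *)
Lemma part_multE m j : odd m -> (part_mult m j + (2 %| j) + (m %| j) = 3 + (2 * m %| j))%N.
Proof.
move=> om; rewrite /part_mult Gauss_dvd ?coprime2n // dvdn2.
by case: (odd j); case: (m %| j)%N.
Qed.

Lemma prod_part_mult m : odd m ->
  eqX ((\prod_(1 <= j < N.+1) omX j ^+ part_mult m j) * (eulerX 2 * eulerX m))
      (eulerX 1 ^+ 3 * eulerX (2 * m)).
Proof.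
move=> om; have m0 : (0 < m)%N by case: m om.
have E1 : eulerX 1 ^+ 3 = \prod_(1 <= j < N.+1) omX j ^+ 3.
  by rewrite prodrXl eulerX1.
apply: (@eqX_trans _ ((\prod_(1 <= j < N.+1) omX j ^+ part_mult m j) *
  ((\prod_(1 <= j < N.+1) omX j ^+ (2 %| j)) * (\prod_(1 <= j < N.+1) omX j ^+ (m %| j))))).
  by apply: eqXM => //; apply: eqXM; apply: eqX_sym; apply: eulerX_dvd.
apply: (@eqX_trans _ (eulerX 1 ^+ 3 * (\prod_(1 <= j < N.+1) omX j ^+ (2 * m %| j)))); last first.
  by apply: eqXM => //; apply: eulerX_dvd; rewrite muln_gt0.
rewrite E1 -!big_split /=.
rewrite (eq_bigr (fun j => omX j ^+ 3 * omX j ^+ (2 * m %| j))) // => j _.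
by rewrite -!exprD addnA part_multE.
Qed.

Lemma trunc_ext f g : f =1 g -> trunc f = trunc g.
Proof. by move=> fg; apply/polyP => i; rewrite !coef_poly fg. Qed.

Lemma diamond_factor_eqX k j : (0 < j)%N ->
  eqX ((omX j ^+ 3 * omX ((4 * k + 2) * j)) * trunc (diamond_factor k j))
      (omX (2 * j) * omX ((2 * k + 1) * j)).
Proof.
move=> hj; rewrite /diamond_factor /fps_div.
set num := fps_mul (one_sub_q (2 * j)) _; set den := fps_mul (fps_exp _ _) _.
have Hnum : eqX (trunc num) (omX (2 * j) * omX ((2 * k + 1) * j)).
  by apply: eqX_trans (trunc_mul _ _) _; apply: eqXM; apply: trunc_one_sub_q.
have Hden : eqX (trunc den) (omX j ^+ 3 * omX ((4 * k + 2) * j)).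
  apply: eqX_trans (trunc_mul _ _) _; apply: eqXM; last exact: trunc_one_sub_q.
  rewrite /fps_exp; elim: (3%N) => [|n IH]; first exact: trunc_one.
  by rewrite exprS; apply: eqX_trans (trunc_mul _ _) _; apply: eqXM => //; apply: trunc_one_sub_q.
have Hinv : eqX (trunc den * trunc (fps_inv den)) 1.
  apply: eqX_trans (eqX_sym (trunc_mul _ _)) _.
  rewrite (trunc_ext (fps_mulV _)); first exact: trunc_one.
  by have [] := @diamond_den_eq1_upto k j 0 hj.
apply: (@eqX_trans _ (trunc den * (trunc num * trunc (fps_inv den)))).
  by apply: eqXM; [exact: eqX_sym | exact: trunc_mul].
rewrite mulrCA -[X in eqX _ X]mulr1; exact: eqXM.
Qed.

Lemma trunc_prod (s : seq nat) (F : nat -> fps) :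
  eqX (trunc (\big[fps_mul/fps_one]_(j <- s) F j)) (\prod_(j <- s) trunc (F j)).
Proof.
elim: s => [|j s IH]; first by rewrite !big_nil; apply: trunc_one.
by rewrite !big_cons; apply: eqX_trans (trunc_mul _ _) _; apply: eqXM.
Qed.

Lemma trunc_diamond k Delta : is_fps_prod (diamond_factor k) Delta ->
  eqX (eulerX 1 ^+ 3 * eulerX (2 * (2 * k + 1)) * trunc Delta) (eulerX 2 * eulerX (2 * k + 1)).
Proof.
move=> hD.
have hDN : eqX (trunc Delta) (\prod_(1 <= j < N.+1) trunc (diamond_factor k j)).
  apply: eqX_trans (trunc_prod _ _) => i hi; rewrite !coef_trunc //.
  (* The partial product at [maxn N0 N] links the limit, reached from [N0] on, with the product up
     to [N], stable in degrees up to [N]. *)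
  have [N0 H] := hD i; rewrite -(H (maxn N0 N)) ?leq_maxl //.
  rewrite diamond_partial_prod_stable; last by rewrite leq_max hi orbT.
  by rewrite -(diamond_partial_prod_stable k hi).
apply: (@eqX_trans _ (\prod_(1 <= j < N.+1)
    ((omX j ^+ 3 * omX ((4 * k + 2) * j)) * trunc (diamond_factor k j)))).
  rewrite 2!big_split /=; apply: eqXM => //; rewrite prodrXl -eulerX1 /eulerX.
  by rewrite (_ : 4 * k + 2 = 2 * (2 * k + 1))%N //; lia.
rewrite /eulerX -big_split /=.
by apply: eqX_prod => j; rewrite mem_index_iota => /andP[hj _]; apply: diamond_factor_eqX.
Qed.

Lemma trunc_partgf L : all_pos L ->
  eqX ((\prod_(j <- L) omX j) * trunc (fun n => int_of_Z (partgf L n))) 1.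
Proof.
elim: L => [|j L IH] hL.
  rewrite big_nil mul1r => i hi; rewrite coef_trunc // coef1 /=.
  by case: i hi.
have [hj hL'] : (1 <= j)%coq_nat /\ all_pos L by inversion hL.
rewrite big_cons mulrAC; apply: eqX_trans (IH hL') => {IH}.
rewrite mulrC; apply: eqXM => // i hi.
have hij' : (i - j <= N)%N := leq_trans (leq_subr _ _) hi.
rewrite mulrBl mul1r coefB coefXnM !coef_trunc //= geomZ_rec //.
case: PeanoNat.Nat.leb_spec => hij.
  by rewrite ltnNge (introT leP hij) int_of_ZD addrK.
by rewrite (introT ltP hij) subr0 int_of_ZD addr0.
Qed.

Lemma prod_parts (c : nat -> nat) (F : nat -> {poly int}) M :
  \prod_(j <- parts c M) F j = \prod_(1 <= j < M.+1) F j ^+ c j.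
Proof.
rewrite /parts /index_iota subn1 /=.
elim: M 1%N => [|M IH] a; first by rewrite !big_nil.
rewrite /= big_cat big_cons IH; congr (_ * _).
by elim: (c a) => [|n IHn]; rewrite ?big_nil // /= big_cons exprS IHn.
Qed.

(** Both sequences are inverses of the same product [A] modulo ['X^(N+1)], and [A] can be cancelled
    because its constant term is 1. *)
Lemma diamond_partgf k Delta : is_fps_prod (diamond_factor k) Delta -> forall i, (i <= N)%N ->
  Delta i = int_of_Z (partgf (parts (part_mult (2 * k + 1)) N) i).
Proof.
move=> hD i hi; set m := (2 * k + 1)%N; set L := parts _ _.
have om : odd m by rewrite /m oddD oddM.
have m0 : (0 < m)%N by rewrite /m addn1.
have hL : all_pos L.
  have [] := @two_or_three_parts (part_mult m) N => [j|//].
  by rewrite /part_mult; case: ifP => _; lia.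
pose A := \prod_(1 <= j < N.+1) omX j ^+ part_mult m j.
have A0 : A`_0 = 1.
  rewrite /A big_seq; apply: (big_ind (fun p : {poly int} => p`_0 = 1)).
  - by rewrite coef1.
  - exact: coef0_mul_eq1.
  - move=> j; rewrite mem_index_iota => /andP[hj _].
    elim: (part_mult m j) => [|n IH]; first by rewrite expr0 coef1.
    by rewrite exprS; apply: coef0_mul_eq1 => //; apply: omX_coef0.
have AD : eqX (A * trunc Delta) 1.
  apply: (@eqX_cancel (eulerX 2 * eulerX m)).
    by apply: coef0_mul_eq1; apply: eulerX_coef0.
  rewrite mulr1 mulrA [_ * A]mulrC.
  apply: eqX_trans _ (trunc_diamond hD); apply: eqXM => //; exact: prod_part_mult.
have AQ : eqX (A * trunc (fun n => int_of_Z (partgf L n))) 1.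
  by rewrite /A -prod_parts; apply: trunc_partgf.
have := eqX_cancel A0 (eqX_trans AD (eqX_sym AQ)) hi.
by rewrite !coef_trunc.
Qed.

Lemma polyZ_series_mul gs l : size l = N.+1 ->
  eqX (polyZ (series_mul gs l nil)) ((1 + spoly gs) * polyZ l).
Proof.
move=> hl i hi; rewrite coef_polyZ series_mulE ?hl // coefM big_mkord.
by apply: eq_bigr => e _; rewrite coef_polyZ.
Qed.

Lemma polyZ_series_div gs l : (spoly gs)`_0 = 0 -> size l = N.+1 ->
  eqX ((1 + spoly gs) * polyZ (series_div gs l nil)) (polyZ l).
Proof.
move=> s0 hl i hi; rewrite coef_polyZ -(@series_divE gs l [::] i s0) ?hl // coefM big_mkord.
by apply: eq_bigr => e _; rewrite coef_polyZ.
Qed.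

Hypotheses (hN33 : (33 <= N)%N) (hN : (N < 1717)%N).

Lemma eulerX_gaps d : (0 < d)%N -> eqX (eulerX d) (1 + spoly (gaps d 1 33)).
Proof.
move=> hd; have := @eulerX_pentagonal d 33 hd hN33; rewrite -[pent_lo 34]/1717%N => /(_ hN).
by have := gaps_spoly d 0 33; rewrite expr0 mul1r add0n => <-.
Qed.

Lemma eulerX_series_mul d l : (0 < d)%N -> size l = N.+1 ->
  eqX (polyZ (series_mul (gaps d 1 33) l nil)) (eulerX d * polyZ l).
Proof.
move=> hd hl; apply: eqX_trans (polyZ_series_mul _ hl) _.
by apply: eqXM => //; apply: eqX_sym; apply: eulerX_gaps.
Qed.

Lemma eulerX_series_div d l : (0 < d)%N -> size l = N.+1 ->
  eqX (eulerX d * polyZ (series_div (gaps d 1 33) l nil)) (polyZ l).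
Proof.
move=> hd hl; apply: eqX_trans (polyZ_series_div (gaps_coef0 33 hd) hl).
by apply: eqXM => //; apply: eulerX_gaps.
Qed.

Lemma size_euler_quotient : size (euler_quotient N) = N.+1.
Proof.
rewrite /euler_quotient !size_series_div size_series_mul /=; congr _.+1.
by elim: N => //= n ->.
Qed.

Lemma size_diamond_list m : size (diamond_list m N) = N.+1.
Proof. by rewrite /diamond_list /diamond_of size_series_div size_series_mul size_euler_quotient. Qed.

Lemma euler_quotientE : eqX (eulerX 1 ^+ 3 * polyZ (euler_quotient N)) (eulerX 2).
Proof.
have s0 : size (Zpos xH :: List.repeat Z0 N) = N.+1 by rewrite /=; congr _.+1; elim: N => //= n ->.
rewrite /euler_quotient; set l1 := series_mul _ _ _.
have s1 : size l1 = N.+1 by rewrite size_series_mul.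
have H1 : eqX (polyZ l1) (eulerX 2).
  apply: eqX_trans (eulerX_series_mul _ s0) _ => //.
  rewrite -[X in eqX _ X]mulr1; apply: eqXM => // i hi.
  rewrite coef_polyZ coef1 /nthZ; case: i hi => [|i] hi //=.
  by elim: N i {hi} => [|n IH] [|i] //=; rewrite ?nth_nil.
have step l : size l = N.+1 -> eqX (eulerX 1 * polyZ (series_div (gaps 1 1 33) l nil)) (polyZ l).
  exact: eulerX_series_div.
rewrite !exprS expr0 mulr1 -!mulrA; apply: eqX_trans H1.
apply: eqX_trans (step _ s1); apply: eqXM => //.
apply: eqX_trans (step _ _); last by rewrite size_series_div.
by apply: eqXM => //; apply: step; rewrite !size_series_div.
Qed.

Lemma diamond_listE k Delta : is_fps_prod (diamond_factor k) Delta -> forall i, (i <= N)%N ->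
  Delta i = nthZ (diamond_list (2 * k + 1) N) i.
Proof.
move=> hD i hi; set m := (2 * k + 1)%N.
have m0 : (0 < m)%N by rewrite /m addn1.
have H : eqX (eulerX 1 ^+ 3 * eulerX (2 * m) * polyZ (diamond_list m N)) (eulerX 2 * eulerX m).
  rewrite -mulrA; apply: (@eqX_trans _ (eulerX 1 ^+ 3 * (eulerX m * polyZ (euler_quotient N)))).
    apply: eqXM => //; apply: eqX_trans (eulerX_series_div _ _) _.
    - by rewrite muln_gt0.
    - by rewrite size_series_mul size_euler_quotient.
    - by apply: eulerX_series_mul => //; apply: size_euler_quotient.
  by rewrite mulrCA [X in eqX _ X]mulrC; apply: eqXM => //; apply: euler_quotientE.
have U0 : (eulerX 1 ^+ 3 * eulerX (2 * m))`_0 = 1.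
  apply: coef0_mul_eq1; last by apply: eulerX_coef0; rewrite muln_gt0.
  by rewrite !exprS expr0 mulr1; do 2?apply: coef0_mul_eq1; apply: eulerX_coef0.
have := eqX_cancel U0 (eqX_trans (trunc_diamond hD) (eqX_sym H)) hi.
by rewrite coef_trunc // coef_polyZ.
Qed.

End Truncation.

(** * The inequality for all indices *)

Lemma lengthE (l : seq Z) : List.length l = size l.
Proof. by elim: l => //= x l ->. Qed.

Lemma nthE (l : seq Z) i : List.nth i l Z0 = nth Z0 l i.
Proof. by elim: l i => [|x l IH] [|i] //=. Qed.

Lemma diamond_log_concave_small k Delta N n : k = 1%N \/ k = 2%N ->
  (33 <= N)%N -> (N < 1717)%N -> diamond_check N = true ->
  is_fps_prod (diamond_factor k) Delta -> (1 <= n < N)%N ->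
  Delta (n - 1)%N * Delta (n + 1)%N <= Delta n ^+ 2.
Proof.
move=> hk hN33 hN hc hD /andP[n1 hn].
have hm : (2 * k + 1 = 3)%N \/ (2 * k + 1 = 5)%N by case: hk => ->; [left|right].
have := diamond_listE hN33 hN hD; move: (2 * k + 1)%N hm => m hm E.
rewrite !E; [|lia..].
case: n n1 hn => // n _ hn; rewrite subn1 addn1 /= /nthZ.
have := @diamond_list_log_concave _ N n hm hc.
rewrite lengthE size_diamond_list !nthE.
move: (nth _ _ n) (nth _ _ n.+1) (nth _ _ n.+2) => a b c H.
have {}H : Z.le (Z.mul a c) (Z.mul b b) by apply: H; lia.
by rewrite expr2 -!int_of_ZM; apply: int_of_Z_le.
Qed.

Theorem theorem1p4 (k : nat) (hk : k = 1%N \/ k = 2%N)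
    (Delta : nat -> int) (hDelta : is_fps_prod (diamond_factor k) Delta)
    (n : nat) (hn : (1 <= n)%N) :
  Delta n ^+ 2 >= Delta (n - 1)%N * Delta (n + 1)%N.
Proof.
case: (ltnP n 1600) => hn'.
  apply: (diamond_log_concave_small (N := 1601) hk _ _ diamond_check_1601 hDelta) => //.
  by rewrite hn (ltn_trans hn').
have hc j : Peano.le 2 (part_mult (2 * k + 1) j) /\ Peano.le (part_mult (2 * k + 1) j) 3 by rewrite /part_mult; case: ifP => _; lia.
(* Asking for [N >= n + 1] makes [diamond_partgf] apply to all three coefficients at [n - 1], [n]
   and [n + 1]. *)
have [N [hN H]] := @partgf_log_concave (parts (part_mult (2 * k + 1)))
  (fun N => @two_or_three_parts _ N hc) n n.+1 (elimT leP hn').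
rewrite !(diamond_partgf (N := N) hDelta); [|lia..].
move: H; rewrite -[(n - 1)%coq_nat]/(n - 1)%N -[(n + 1)%coq_nat]/(n + 1)%N.
move: (partgf _ (n - 1)%N) (partgf _ (n + 1)%N) (partgf _ n) => a c b H.
by rewrite expr2 -!int_of_ZM; apply: int_of_Z_le.
Qed.
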